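(* Let $V$ be a finite dimensional vector space. The functor $(-)_{V,\mathsf{wh}}\colon\mathsf{WAlg}\to\mathsf{CAlg}$ from wheelgebras to commutative algebras, $\mathcal A\mapsto(\sqrt[V,\mathsf{wh}]{\mathcal A})_{\mathrm{ab}}$, is left adjoint to the functor $\mathsf{CAlg}\to\mathsf{WAlg}$ given by the restriction of $\mathcal E_V$ to the category of commutative algebras.
   Context: Conventions. $k$ is a field of characteristic $0$; vector spaces, algebras and $\otimes$ are over $k$; algebras are associative with unit. $\mathbb N_0=\{0,1,2,\dots\}$, $\mathbb N=\{1,2,\dots\}$. $\mathbb S_n$ is the group of permutations of $\{1,\dots,n\}$ (product = composition of maps); $\mathbb S_n\times\mathbb S_m\subseteq\mathbb S_{n+m}$ ($\mathbb S_n$ on the first $n$ letters, $\mathbb S_m$ on the last $m$). A diagonal $\mathbb S$-bimodule is a sequence $S=(S(n))_{n\in\mathbb N_0}$ of $k\mathbb S_n$-bimodules; morphisms are sequences of bimodule maps. Wheelspaces. For $\sigma\in\mathbb S_n$ and $1\le i\le n$, $r^n_i(\sigma)\in\mathbb S_{n-1}$ is obtained from $\sigma$ by deleting $i$ from the source and $\sigma(i)$ from the target and renumbering in the order-preserving way; $l^n_j(\sigma)=(r^n_j(\sigma^{-1}))^{-1}$. A wheelspace is a diagonal $\mathbb S$-bimodule $S$ with linear maps (contractions) ${}^n_jt_i\colon S(n)\to S(n-1)$, $n\in\mathbb N$, $1\le i,j\le n$, such that (W1) ${}^n_jt_i(\sigma v\tau)=l^n_j(\sigma)\cdot{}^{\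 \ \ \ n}_{\sigma^{-1}(j)}t_{\tau(i)}(v)\cdot r^n_i(\tau)$ for $\sigma,\tau\in\mathbb S_n$; (W2) ${}^n_jt_i\circ{}^{n+1}_{\ \ \ell}t_k={}^n_{j'}t_{i'}\circ{}^{n+1}_{\ \ \ell'}t_{k'}$, where $(i',k')=(k-1,i)$ if $i<k$ and $(k,i+1)$ if $k\le i$, and $(j',\ell')$ is obtained from $(j,\ell)$ by the same rule. Morphisms of wheelspaces are morphisms of diagonal $\mathbb S$-bimodules commuting with all contractions. Wheelgebras. A wheelgebra is a wheelspace $\mathcal A$ with linear maps $\mu_{n,m}\colon\mathcal A(n)\otimes\mathcal A(m)\to\mathcal A(n+m)$ (written $ab$) that are morphisms of $k(\mathbb S_n\times\mathbb S_m)$-bimodules, associative, with a unit $1_{\mathcal A}\in\mathcal A(0)$, and compatible with contractions: ${}^{n+m}_{\ \ \ j}t_i(ab)=({}^n_jt_i a)b$ if $i,j\le n$ and $=a({}^{\ \ m}_{j-n}t_{i-n}b)$ if $i,j>n$. Morphisms are morphisms of wheelspaces preserving products and units; the category is $\mathsf{WAlg}$. The functors. For an algebra $B$, $\mathcal E_V(B)$ is the wheelgebra with $\mathcal E_V(B)(n)=\mathrm{End}(V^{\otimes n})\otimes B$, actions $\sigma'\cdot(f\otimes b)\cdot\sigma=\sigma'\circ f\circ\sigma\otimes b$ where $\sigma(v_1\otimes\dots\otimes v_n)=v_{\sigma^{-1}(1)}\otimes\dots\otimes v_{\sigma^{-1}(n)}$, product $(f\otimes b)(g\otimes b')=(f\otimes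 g)\otimes bb'$, unit $1\otimes1_B$, and contractions ${}^n_jt_i(f\otimes b)=\mathrm{tr}_{j,i}(f)\otimes b$, where, for a basis $\{e_\alpha\}$ of $V$ with dual basis $\{e^*_\alpha\}$, $\mathrm{tr}_{j,i}(f)(v_1\otimes\dots\otimes v_{n-1})=\sum_\alpha(\mathrm{id}^{\otimes(j-1)}\otimes e_\alpha^*\otimes\mathrm{id}^{\otimes(n-j)})f(v_1\otimes\dots\otimes v_{i-1}\otimes e_\alpha\otimes v_i\otimes\dots\otimes v_{n-1})$. On morphisms $\mathcal E_V(f)=\mathrm{id}\otimes f$. The functor $\mathcal E_V$ from algebras to wheelgebras has a left adjoint, denoted $\sqrt[V,\mathsf{wh}]{-}$. For an algebra $B$, $B_{\mathrm{ab}}$ is the quotient of $B$ by the two-sided ideal generated by the commutators. $\mathsf{CAlg}$ is the category of commutative algebras. *)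

(* Defs.v *)
From HB Require Import structures.
From mathcomp Require Import all_boot all_fingroup all_algebra.
From mathcomp Require Import boolp.
From mathcomp Require Import zify.
Set Implicit Arguments.
Unset Strict Implicit.
Unset Printing Implicit Defensive.
Import GRing.Theory.
Local Open Scope ring_scope.
Local Open Scope quotient_scope.
Local Notation repr := generic_quotient.repr.

Section LinearMaps.
Variables (k : fieldType) (U W : lmodType k).

Definition mklinear (f : U -> W) (fL : linear f) : {linear U -> W} :=
  HB.pack_for {linear U -> W} f (GRing.isLinear.Build k U W *:%R f fL).

Lemma linear_ext (f g : {linear U -> W}) : f =1 g -> f = g.
Proof.
move=> /funext; case: f => f [[a] [b]]; case: g => g [[a'] [b']] /= fg.
by subst g; rewrite (Prop_irrelevance a a') (Prop_irrelevance b b').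
Qed.

HB.instance Definition _ := gen_eqMixin {linear U -> W}.
HB.instance Definition _ := gen_choiceMixin {linear U -> W}.

Implicit Types f g h : {linear U -> W}.
Let add f g : {linear U -> W} := f \+ g.
Let opp f : {linear U -> W} := \- f.
Let zero : {linear U -> W} := \0.
Let scale (a : k) f : {linear U -> W} := a \*: f.
Let addA : associative add.
Proof. by move=> f g h; apply: linear_ext => u /=; rewrite addrA. Qed.
Let addC : commutative add.
Proof. by move=> f g; apply: linear_ext => u /=; rewrite addrC. Qed.
Let add0 : left_id zero add.
Proof. by move=> f; apply: linear_ext => u /=; rewrite add0r. Qed.
Let addN : left_inverse zero opp add.
Proof. by move=> f; apply: linear_ext => u /=; rewrite addNr. Qed.
HB.instance Definition _ :=
  GRing.isZmodule.Build {linear U -> W} addA addC add0 addN.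
Let scaleA a b f : scale a (scale b f) = scale (a * b) f.
Proof. by apply: linear_ext => u /=; rewrite scalerA. Qed.
Let scale1 : left_id 1 scale.
Proof. by move=> f; apply: linear_ext => u /=; rewrite scale1r. Qed.
Let scaleDr : right_distributive scale +%R.
Proof. by move=> a f g; apply: linear_ext => u /=; rewrite scalerDr. Qed.
Let scaleDl f : {morph scale^~ f : a b / a + b}.
Proof. by move=> a b; apply: linear_ext => u /=; rewrite scalerDl. Qed.
HB.instance Definition _ :=
  GRing.Zmodule_isLmodule.Build k {linear U -> W} scaleA scale1 scaleDr scaleDl.

Lemma addLE f g u : (f + g) u = f u + g u. Proof. by []. Qed.
Lemma scaleLE a f u : (a *: f) u = a *: f u. Proof. by []. Qed.
Lemma sumLE (I : Type) (r : seq I) (P : pred I) (F : I -> {linear U -> W}) u :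
  (\sum_(i <- r | P i) F i) u = \sum_(i <- r | P i) F i u.
Proof. by apply: (big_morph (fun f : {linear U -> W} => f u)). Qed.
End LinearMaps.

Lemma compLE (k : fieldType) (U W Z : lmodType k) (g : {linear W -> Z})
  (f : {linear U -> W}) u : (g \o f : {linear U -> Z}) u = g (f u).
Proof. by []. Qed.

(* The vector space generated by X subject to the relations that hold for all  *)
(* maps X -> Z in the class C: formal sums are identified when every map of C  *)
(* sends them to the same vector.                                              *)
Section Presented.
Variables (k : fieldType) (X : choiceType).
Variable C : forall Z : lmodType k, (X -> Z) -> Prop.

Definition formal_eval (Z : lmodType k) (phi : X -> Z) (s : seq (k * X)) : Z :=
  \sum_(p <- s) p.1 *: phi p.2.

Definition formal_eq (s t : seq (k * X)) : bool :=
  `[< forall (Z : lmodType k) (phi : X -> Z),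
      C phi -> formal_eval phi s = formal_eval phi t >].

Let formal_eq_refl : reflexive formal_eq.
Proof. by move=> s; apply/asboolP. Qed.
Let formal_eq_sym : symmetric formal_eq.
Proof.
by move=> s t; apply/asboolP/asboolP => h Z phi Cphi; apply/esym/h.
Qed.
Let formal_eq_trans : transitive formal_eq.
Proof.
move=> t s u /asboolP st /asboolP tu; apply/asboolP => Z phi Cphi.
by rewrite st ?tu.
Qed.
Canonical formal_equiv :=
  EquivRel formal_eq formal_eq_refl formal_eq_sym formal_eq_trans.

Definition presented := {eq_quot formal_equiv}.
HB.instance Definition _ := Choice.on presented.

Implicit Types x y z : presented.

Definition pgen (u : X) : presented := \pi_({eq_quot formal_equiv}) [:: (1, u)].
Definition plift (Z : lmodType k) (phi : X -> Z) (x : presented) : Z :=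
  formal_eval phi (repr x).

Let plift_pi (Z : lmodType k) (phi : X -> Z) s :
  C phi -> plift phi (\pi_({eq_quot formal_equiv}) s) = formal_eval phi s.
Proof.
move=> Cphi; have /eqmodP/asboolP : repr (\pi_({eq_quot formal_equiv}) s) = s %[mod {eq_quot formal_equiv}].
  by rewrite reprK.
by apply.
Qed.

Lemma presented_ext x y :
  (forall (Z : lmodType k) (phi : X -> Z), C phi -> plift phi x = plift phi y) ->
  x = y.
Proof. by move=> h; rewrite -[x]reprK -[y]reprK; apply/eqmodP/asboolP. Qed.

Let padd x y : presented := \pi_({eq_quot formal_equiv}) (repr x ++ repr y).
Let pscale (a : k) x : presented := \pi_({eq_quot formal_equiv}) [seq (a * p.1, p.2) | p <- repr x].
Let popp x : presented := pscale (-1) x.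
Let pzero : presented := \pi_({eq_quot formal_equiv}) [::].

Let plift0 (Z : lmodType k) (phi : X -> Z) : C phi -> plift phi pzero = 0.
Proof. by move=> h; rewrite plift_pi // /formal_eval big_nil. Qed.
Let pliftD (Z : lmodType k) (phi : X -> Z) x y : C phi -> plift phi (padd x y) = plift phi x + plift phi y.
Proof. by move=> h; rewrite plift_pi // /formal_eval big_cat. Qed.
Let pliftZ (Z : lmodType k) (phi : X -> Z) a x : C phi -> plift phi (pscale a x) = a *: plift phi x.
Proof.
move=> h; rewrite plift_pi // /formal_eval big_map scaler_sumr.
by apply: eq_bigr => p _; rewrite scalerA.
Qed.
Let pliftN (Z : lmodType k) (phi : X -> Z) x : C phi -> plift phi (popp x) = - plift phi x.
Proof. by move=> h; rewrite pliftZ // scaleN1r. Qed.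

Let paddA : associative padd.
Proof. by move=> x y z; apply: presented_ext => Z p h; rewrite !pliftD // addrA. Qed.
Let paddC : commutative padd.
Proof. by move=> x y; apply: presented_ext => Z p h; rewrite !pliftD // addrC. Qed.
Let padd0 : left_id pzero padd.
Proof. by move=> x; apply: presented_ext => Z p h; rewrite pliftD // plift0 // add0r. Qed.
Let paddN : left_inverse pzero popp padd.
Proof.
by move=> x; apply: presented_ext => Z p h; rewrite pliftD // pliftN // plift0 // addNr.
Qed.
HB.instance Definition _ := GRing.isZmodule.Build presented paddA paddC padd0 paddN.
Let pscaleA a b x : pscale a (pscale b x) = pscale (a * b) x.
Proof. by apply: presented_ext => Z p h; rewrite !pliftZ // scalerA. Qed.
Let pscale1 : left_id 1 pscale.
Proof. by move=> x; apply: presented_ext => Z p h; rewrite !pliftZ // scale1r. Qed.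
Let pscaleDr : right_distributive pscale +%R.
Proof.
by move=> a x y; apply: presented_ext => Z p h; rewrite !(pliftD, pliftZ) // scalerDr.
Qed.
Let pscaleDl x : {morph pscale^~ x : a b / a + b}.
Proof.
by move=> a b; apply: presented_ext => Z p h; rewrite !(pliftD, pliftZ) // scalerDl.
Qed.
HB.instance Definition _ :=
  GRing.Zmodule_isLmodule.Build k presented pscaleA pscale1 pscaleDr pscaleDl.

Lemma plift_linear (Z : lmodType k) (phi : X -> Z) : C phi -> linear (plift phi).
Proof. by move=> h a x y; rewrite [LHS]pliftD // pliftZ. Qed.

Lemma plift_gen (Z : lmodType k) (phi : X -> Z) u : C phi -> plift phi (pgen u) = phi u.
Proof. by move=> h; rewrite plift_pi // /formal_eval big_seq1 scale1r. Qed.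

Lemma presented_span x : exists s : seq (k * X), x = \sum_(p <- s) p.1 *: pgen p.2.
Proof.
exists (repr x); apply: presented_ext => Z phi h.
pose L := mklinear (plift_linear h).
rewrite -[RHS]/(L _) linear_sum; apply: eq_bigr => p _.
by rewrite linearZ /= plift_gen.
Qed.

Lemma presented_linear_ext (Z : lmodType k) (f g : presented -> Z) :
  linear f -> linear g -> (forall u, f (pgen u) = g (pgen u)) -> f =1 g.
Proof.
move=> fL gL fg x; have [s ->] := presented_span x.
rewrite -[f]/(mklinear fL : _ -> _) -[g]/(mklinear gL : _ -> _) !linear_sum.
by apply: eq_bigr => p _; rewrite !linearZ /= fg.
Qed.
End Presented.

Lemma lin_id (k : fieldType) (U : lmodType k) : linear (fun u : U => u).
Proof. by []. Qed.
Lemma lin_comp (k : fieldType) (U W Z : lmodType k) (g : W -> Z) (f : U -> W) :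
  linear g -> linear f -> linear (fun u => g (f u)).
Proof. by move=> gL fL a u v; rewrite fL gL. Qed.
Lemma lin_comb (k : fieldType) (U W : lmodType k) (a : k) (f g : U -> W) :
  linear f -> linear g -> linear (fun u => a *: f u + g u).
Proof.
move=> fL gL c u v; rewrite fL gL !scalerDr !scalerA mulrC -!addrA.
by congr (_ + _); rewrite addrCA.
Qed.

Section Tensor.
Variables (k : fieldType) (U W : lmodType k).

Definition bilinear (Z : lmodType k) (beta : U -> W -> Z) : Prop :=
  (forall w, linear (beta^~ w)) /\ (forall u, linear (beta u)).

Definition bilinear_class (Z : lmodType k) (beta : U * W -> Z) : Prop :=
  bilinear (fun u w => beta (u, w)).

Definition tensor := presented bilinear_class.
HB.instance Definition _ := GRing.Lmodule.on tensor.

Definition tens (u : U) (w : W) : tensor := pgen bilinear_class (u, w).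

Definition tlift (Z : lmodType k) (beta : U -> W -> Z) : tensor -> Z :=
  plift (fun p : U * W => beta p.1 p.2).

Lemma tlift_linear (Z : lmodType k) (beta : U -> W -> Z) :
  bilinear beta -> linear (tlift beta).
Proof. by move=> h; apply: plift_linear. Qed.

Lemma tliftE (Z : lmodType k) (beta : U -> W -> Z) u w :
  bilinear beta -> tlift beta (tens u w) = beta u w.
Proof. by move=> h; rewrite /tlift plift_gen. Qed.

Lemma tensor_linear_ext (Z : lmodType k) (f g : tensor -> Z) :
  linear f -> linear g -> (forall u w, f (tens u w) = g (tens u w)) -> f =1 g.
Proof. by move=> fL gL fg; apply: presented_linear_ext => // -[u w]; apply: fg. Qed.

Lemma tens_bilinear : bilinear tens.
Proof.
split=> [w a u u' | u a w w']; apply: presented_ext => Z phi h;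
  rewrite plift_linear // !plift_gen //; [exact: h.1|exact: h.2].
Qed.
End Tensor.

Section TensorPower.
Variables (k : fieldType) (V : lmodType k) (n : nat).

Definition update (v : {ffun 'I_n -> V}) (i : 'I_n) (x : V) : {ffun 'I_n -> V} :=
  [ffun j => if j == i then x else v j].

Definition multilinear (Z : lmodType k) (phi : {ffun 'I_n -> V} -> Z) : Prop :=
  forall (v : {ffun 'I_n -> V}) (i : 'I_n), linear (fun x => phi (update v i x)).

Definition tpow := presented multilinear.
HB.instance Definition _ := GRing.Lmodule.on tpow.

Definition tprod (v : {ffun 'I_n -> V}) : tpow := pgen multilinear v.

Definition mlift (Z : lmodType k) (phi : {ffun 'I_n -> V} -> Z) : tpow -> Z :=
  plift phi.

Lemma mlift_linear (Z : lmodType k) (phi : {ffun 'I_n -> V} -> Z) :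
  multilinear phi -> linear (mlift phi).
Proof. exact: plift_linear. Qed.

Lemma mliftE (Z : lmodType k) (phi : {ffun 'I_n -> V} -> Z) v :
  multilinear phi -> mlift phi (tprod v) = phi v.
Proof. by move=> h; rewrite /mlift plift_gen. Qed.

Lemma tpow_linear_ext (Z : lmodType k) (f g : tpow -> Z) :
  linear f -> linear g -> (forall v, f (tprod v) = g (tprod v)) -> f =1 g.
Proof. exact: presented_linear_ext. Qed.

Lemma tprod_multilinear : multilinear tprod.
Proof.
move=> v i a x y; apply: presented_ext => Z phi h.
by rewrite plift_linear // !plift_gen //; apply: h.
Qed.
End TensorPower.

Lemma linear_linear (k : fieldType) (U W : lmodType k) (f : {linear U -> W}) :
  linear f.
Proof. exact: linearP. Qed.

Lemma bilinear_ext2 (k : fieldType) (U W U' W' Z : lmodType k)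
    (f g : tensor U W -> tensor U' W' -> Z) :
  bilinear f -> bilinear g ->
  (forall u w u' w', f (tens u w) (tens u' w') = g (tens u w) (tens u' w')) ->
  forall x y, f x y = g x y.
Proof.
move=> [f1 f2] [g1 g2] fg x y; move: x.
apply: tensor_linear_ext => // u w; move: y.
by apply: tensor_linear_ext => // u' w'.
Qed.

Lemma tpow_bilinear_ext (k : fieldType) (V Z : lmodType k) (n m : nat)
    (f g : tpow V n -> tpow V m -> Z) :
  bilinear f -> bilinear g ->
  (forall v w, f (tprod v) (tprod w) = g (tprod v) (tprod w)) ->
  forall x y, f x y = g x y.
Proof.
move=> [f1 f2] [g1 g2] fg x y; move: x.
apply: tpow_linear_ext => // v; move: y.
by apply: tpow_linear_ext => // w.
Qed.

Section TensorPowerOps.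
Variables (k : fieldType) (V : lmodType k).
Local Notation T := (tpow V).

Section Perm.
Variable n : nat.
(* v_1 (x) ... (x) v_n is sent to v_(s^-1 1) (x) ... (x) v_(s^-1 n). *)
Definition perm_tuple (s : 'S_n) (v : {ffun 'I_n -> V}) : {ffun 'I_n -> V} :=
  [ffun j => v ((s^-1)%g j)].

Lemma perm_tuple_mlin (s : 'S_n) : multilinear (fun v => tprod (perm_tuple s v)).
Proof.
move=> v i a x y.
have upd z : perm_tuple s (update v i z) = update (perm_tuple s v) (s i) z.
  by apply/ffunP => j; rewrite !ffunE (can2_eq (permKV s) (permK s)).
by rewrite !upd; apply: tprod_multilinear.
Qed.

Definition perm_op (s : 'S_n) : {linear T n -> T n} :=
  mklinear (mlift_linear (perm_tuple_mlin s)).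

Lemma perm_opE s v : perm_op s (tprod v) = tprod (perm_tuple s v).
Proof. exact: (mliftE _ (perm_tuple_mlin s)). Qed.
End Perm.

Section Insert.
Variable n : nat.

(* e becomes the factor with index i. *)
Definition ins_tuple (i : 'I_n.+1) (e : V) (v : {ffun 'I_n -> V}) :
    {ffun 'I_n.+1 -> V} :=
  [ffun m => if unlift i m is Some m' then v m' else e].
Definition del_tuple (j : 'I_n.+1) (v : {ffun 'I_n.+1 -> V}) : {ffun 'I_n -> V} :=
  [ffun m => v (lift j m)].

Lemma ins_tuple_mlin i e : multilinear (fun v => tprod (ins_tuple i e v)).
Proof.
move=> v j a x y.
have upd z : ins_tuple i e (update v j z) = update (ins_tuple i e v) (lift i j) z.
  apply/ffunP => m; rewrite !ffunE; case: unliftP => [m' ->|->].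
    by rewrite ffunE (inj_eq lift_inj).
  by rewrite (negPf (neq_lift i j)).
by rewrite !upd; apply: tprod_multilinear.
Qed.

Definition ins_op (i : 'I_n.+1) (e : V) : {linear T n -> T n.+1} :=
  mklinear (mlift_linear (ins_tuple_mlin i e)).

Lemma ins_opE i e v : ins_op i e (tprod v) = tprod (ins_tuple i e v).
Proof. exact: (mliftE _ (ins_tuple_mlin i e)). Qed.

Lemma con_tuple_mlin (j : 'I_n.+1) (xi : {linear V -> k^o}) :
  multilinear (fun v : {ffun 'I_n.+1 -> V} => (xi (v j) : k) *: tprod (del_tuple j v)).
Proof.
move=> v i a x y; case: (unliftP j i) => [i' ->|->].
  have upd z : del_tuple j (update v (lift j i') z) = update (del_tuple j v) i' z.
    by apply/ffunP => m; rewrite !ffunE (inj_eq lift_inj).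
  rewrite !upd tprod_multilinear !ffunE (negPf (neq_lift _ _)).
  by rewrite scalerDr !scalerA mulrC.
have upd z : del_tuple j (update v j z) = del_tuple j v.
  by apply/ffunP => m; rewrite !ffunE eq_sym (negPf (neq_lift _ _)).
by rewrite !upd !ffunE eqxx linearP scalerDl scalerA.
Qed.

Definition con_op (j : 'I_n.+1) (xi : {linear V -> k^o}) : {linear T n.+1 -> T n} :=
  mklinear (mlift_linear (con_tuple_mlin j xi)).

Lemma con_opE j xi v :
  con_op j xi (tprod v) = (xi (v j) : k) *: tprod (del_tuple j v).
Proof. exact: (mliftE _ (con_tuple_mlin j xi)). Qed.
End Insert.

Section Concat.
Variables n m : nat.

Definition cat_tuple (v : {ffun 'I_n -> V}) (w : {ffun 'I_m -> V}) :
    {ffun 'I_(n + m) -> V} :=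
  [ffun j => match split j with inl a => v a | inr b => w b end].

Lemma cat_tuple_lshift v w a : cat_tuple v w (lshift m a) = v a.
Proof. by rewrite ffunE (unsplitK (inl a)). Qed.
Lemma cat_tuple_rshift v w b : cat_tuple v w (rshift n b) = w b.
Proof. by rewrite ffunE (unsplitK (inr b)). Qed.

Definition left_tuple (v : {ffun 'I_(n + m) -> V}) : {ffun 'I_n -> V} :=
  [ffun a => v (lshift m a)].
Definition right_tuple (v : {ffun 'I_(n + m) -> V}) : {ffun 'I_m -> V} :=
  [ffun b => v (rshift n b)].

Lemma left_catK v w : left_tuple (cat_tuple v w) = v.
Proof. by apply/ffunP => a; rewrite ffunE cat_tuple_lshift. Qed.
Lemma right_catK v w : right_tuple (cat_tuple v w) = w.
Proof. by apply/ffunP => a; rewrite ffunE cat_tuple_rshift. Qed.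
Lemma cat_left_right v : cat_tuple (left_tuple v) (right_tuple v) = v.
Proof.
by apply/ffunP => j; rewrite ffunE -{2}[j]splitK; case: (split j) => a; rewrite ffunE.
Qed.

Lemma cat_update_l v w i x :
  cat_tuple (update v i x) w = update (cat_tuple v w) (lshift m i) x.
Proof.
apply/ffunP => j; rewrite [RHS]ffunE; case: (split_ordP j) => a ->.
  by rewrite !cat_tuple_lshift ffunE (inj_eq (@lshift_inj _ _)).
by rewrite !cat_tuple_rshift eq_rlshift.
Qed.
Lemma cat_update_r v w i x :
  cat_tuple v (update w i x) = update (cat_tuple v w) (rshift n i) x.
Proof.
apply/ffunP => j; rewrite [RHS]ffunE; case: (split_ordP j) => a ->.
  by rewrite !cat_tuple_lshift eq_lrshift.
by rewrite !cat_tuple_rshift ffunE (inj_eq (@rshift_inj _ _)).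
Qed.

Lemma cat_mlin_r v : multilinear (fun w => tprod (cat_tuple v w)).
Proof. by move=> w i a x y; rewrite !cat_update_r; apply: tprod_multilinear. Qed.
Lemma cat_mlin_l (y : T m) :
  multilinear (fun v => mlift (fun w => tprod (cat_tuple v w)) y).
Proof.
move=> v i a x x'; move: y; apply: tpow_linear_ext.
- exact: (mlift_linear (cat_mlin_r _)).
- exact: lin_comb (mlift_linear (cat_mlin_r _)) (mlift_linear (cat_mlin_r _)).
move=> w; rewrite !(mliftE _ (cat_mlin_r _)) !cat_update_l.
exact: tprod_multilinear.
Qed.

Definition tcat (x : T n) (y : T m) : T (n + m) :=
  mlift (fun v => mlift (fun w => tprod (cat_tuple v w)) y) x.

Lemma tcatE v w : tcat (tprod v) (tprod w) = tprod (cat_tuple v w).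
Proof. by rewrite /tcat (mliftE _ (cat_mlin_l _)) (mliftE _ (cat_mlin_r _)). Qed.

Lemma tcat_bilinear : bilinear tcat.
Proof.
split=> [y | x a y y']; first exact: (mlift_linear (cat_mlin_l y)).
move: x; apply: tpow_linear_ext.
- exact: (mlift_linear (cat_mlin_l _)).
- exact: lin_comb (mlift_linear (cat_mlin_l _)) (mlift_linear (cat_mlin_l _)).
move=> v; rewrite /tcat !(mliftE _ (cat_mlin_l _)).
exact: (mlift_linear (cat_mlin_r _)).
Qed.

Lemma tens_op_mlin (f : {linear T n -> T n}) (g : {linear T m -> T m}) :
  multilinear (fun v => tcat (f (tprod (left_tuple v))) (g (tprod (right_tuple v)))).
Proof.
move=> v i a x y; rewrite -[v]cat_left_right; case: (split_ordP i) => j ->.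
  rewrite -!cat_update_l !left_catK !right_catK tprod_multilinear linearP.
  exact: tcat_bilinear.1.
rewrite -!cat_update_r !left_catK !right_catK tprod_multilinear linearP.
exact: tcat_bilinear.2.
Qed.

(* f (x) g on V^(n+m), identified with V^n (x) V^m by concatenation. *)
Definition tens_op (f : {linear T n -> T n}) (g : {linear T m -> T m}) :
    {linear T (n + m) -> T (n + m)} :=
  mklinear (mlift_linear (tens_op_mlin f g)).

Lemma tens_opE f g x y : tens_op f g (tcat x y) = tcat (f x) (g y).
Proof.
move: x y; apply: tpow_bilinear_ext.
- split=> [y a x x' | x a y y'];
  by rewrite ?tcat_bilinear.1 ?tcat_bilinear.2 linearP.
- split=> [y a x x' | x a y y'];
  by rewrite linearP ?tcat_bilinear.1 ?tcat_bilinear.2.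
move=> v w; rewrite tcatE /= (mliftE _ (tens_op_mlin f g)).
by rewrite left_catK right_catK.
Qed.
End Concat.

Lemma tcat_ext n m (Z : lmodType k) (f g : {linear T (n + m) -> Z}) :
  (forall v w, f (tcat (tprod v) (tprod w)) = g (tcat (tprod v) (tprod w))) -> f = g.
Proof.
move=> fg; apply: linear_ext; apply: tpow_linear_ext; try exact: linear_linear.
by move=> v; rewrite -[v]cat_left_right -tcatE.
Qed.

Lemma tpow_ext n (Z : lmodType k) (f g : {linear T n -> Z}) :
  (forall v, f (tprod v) = g (tprod v)) -> f = g.
Proof.
by move=> fg; apply: linear_ext; apply: tpow_linear_ext; try exact: linear_linear.
Qed.
End TensorPowerOps.

Lemma lin_scale (k : fieldType) (U W : lmodType k) (f : U -> W) (a : k) u :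
  linear f -> f (a *: u) = a *: f u.
Proof. by move=> fL; rewrite -[f]/(mklinear fL : _ -> _) linearZZ. Qed.
Lemma tcat_bilinearZl (k : fieldType) (V : lmodType k) n m (a : k)
  (x : tpow V n) (y : tpow V m) : tcat (a *: x) y = a *: tcat x y.
Proof. exact: (lin_scale _ _ ((tcat_bilinear V n m).1 y)). Qed.
Lemma tcat_bilinearZr (k : fieldType) (V : lmodType k) n m (a : k)
  (x : tpow V n) (y : tpow V m) : tcat x (a *: y) = a *: tcat x y.
Proof. exact: (lin_scale _ _ ((tcat_bilinear V n m).2 x)). Qed.

(* Associative unital algebras, the zero algebra included: algType only covers *)
(* the nonzero ones, whereas an abelianization may vanish.                     *)
HB.mixin Record Lmodule_isPzAlgebra (k : fieldType) A of GRing.Lmodule k A := {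
  amul : A -> A -> A;
  aone : A;
  amulA : associative amul;
  amul1l : left_id aone amul;
  amul1r : right_id aone amul;
  amulDl : left_distributive amul +%R;
  amulDr : right_distributive amul +%R;
  ascalerAl : forall (a : k) (x y : A), a *: amul x y = amul (a *: x) y;
  ascalerAr : forall (a : k) (x y : A), a *: amul x y = amul x (a *: y)
}.
#[short(type="pzAlgType")]
HB.structure Definition PzAlgebra (k : fieldType) :=
  {A of GRing.Lmodule k A & Lmodule_isPzAlgebra k A}.
HB.instance Definition _ (k : fieldType) (A : pzAlgType k) :=
  GRing.Zmodule_isPzRing.Build (PzAlgebra.sort A)
    amulA amul1l amul1r amulDl amulDr.
Lemma pzscalerAl (k : fieldType) (A : pzAlgType k) (a : k) (x y : A) :
  a *: (x * y) = (a *: x) * y.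
Proof. exact: ascalerAl. Qed.
Lemma pzscalerAr (k : fieldType) (A : pzAlgType k) (a : k) (x y : A) :
  a *: (x * y) = x * (a *: y).
Proof. exact: ascalerAr. Qed.

HB.mixin Record PzAlgebra_hasCommutativeMul (k : fieldType) A of PzAlgebra k A := {
  amulC : commutative (@amul k A)
}.
#[short(type="comPzAlgType")]
HB.structure Definition ComPzAlgebra (k : fieldType) :=
  {A of PzAlgebra k A & PzAlgebra_hasCommutativeMul k A}.

Record alg_hom (k : fieldType) (A B : pzAlgType k) := AlgHom {
  ahom :> A -> B;
  ahom_linear : linear ahom;
  ahom_monoid : GRing.monoid_morphism ahom
}.

Lemma alg_hom_ext (k : fieldType) (A B : pzAlgType k) (f g : alg_hom A B) :
  f =1 g -> f = g.
Proof.
case: f => f f1 f2; case: g => g g1 g2 /= /funext fg; subst g.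
by rewrite (Prop_irrelevance f1 g1) (Prop_irrelevance f2 g2).
Qed.

(* Product of permutations = composition of maps; MathComp's s * t is t \o s.  *)
Definition perm_comp n (s t : 'S_n) : 'S_n := (t * s)%g.

Lemma perm_compE n (s t : 'S_n) x : perm_comp s t x = s (t x).
Proof. exact: permM. Qed.

Section PermDelete.
Variables (n : nat) (i : 'I_n.+1) (s : 'S_n.+1).

Definition rdel_fun (x : 'I_n) : 'I_n := odflt x (unlift (s i) (s (lift i x))).

Lemma lift_rdel_fun x : lift (s i) (rdel_fun x) = s (lift i x).
Proof.
rewrite /rdel_fun; case: unliftP => [y -> //|/perm_inj h].
by have := neq_lift i x; rewrite h eqxx.
Qed.

Lemma rdel_fun_inj : injective rdel_fun.
Proof.
move=> x y /(congr1 (lift (s i))); rewrite !lift_rdel_fun.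
by move/perm_inj/lift_inj.
Qed.

(* s with i removed from the source, s i from the target, and renumbered. *)
Definition rdel : 'S_n := perm rdel_fun_inj.

Lemma lift_rdel x : lift (s i) (rdel x) = s (lift i x).
Proof. by rewrite permE lift_rdel_fun. Qed.
End PermDelete.

Definition ldel n (j : 'I_n.+1) (s : 'S_n.+1) : 'S_n := ((rdel j s^-1)^-1)%g.

Section PermBlock.
Variables (n m : nat) (s : 'S_n) (t : 'S_m).

Definition block_fun (x : 'I_(n + m)) : 'I_(n + m) :=
  match split x with inl a => lshift m (s a) | inr b => rshift n (t b) end.

Lemma block_fun_inj : injective block_fun.
Proof.
move=> x y; rewrite /block_fun; case: (split_ordP x) => a ->;
  case: (split_ordP y) => b ->; move/eqP;
  rewrite ?eq_lshift ?eq_rshift ?eq_lrshift ?eq_rlshift //;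
  by move/eqP/perm_inj ->.
Qed.

Definition perm_block : 'S_(n + m) := perm block_fun_inj.

Lemma perm_block_lshift a : perm_block (lshift m a) = lshift m (s a).
Proof. by rewrite permE /block_fun (unsplitK (inl a)). Qed.
Lemma perm_block_rshift b : perm_block (rshift n b) = rshift n (t b).
Proof. by rewrite permE /block_fun (unsplitK (inr b)). Qed.
End PermBlock.

(* The reindexing (i, k) |-> (i', k') of consecutive contractions: with letters *)
(* numbered from 1, (i', k') = (k - 1, i) if i < k and (k, i + 1) otherwise.    *)
Definition swap_inner n (i : 'I_n.+1) (l : 'I_n.+2) : 'I_n.+1 :=
  if (i < l)%N then inord l.-1 else inord l.
Definition swap_outer n (i : 'I_n.+1) (l : 'I_n.+2) : 'I_n.+2 :=
  if (i < l)%N then inord i else inord i.+1.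

Section Wheels.
Variable k : fieldType.

Record diag_bimodule := DiagBimodule {
  db_sort :> nat -> lmodType k;
  lact : forall n, 'S_n -> db_sort n -> db_sort n;
  ract : forall n, db_sort n -> 'S_n -> db_sort n;
  lact_linear : forall n (s : 'S_n), linear (lact s);
  ract_linear : forall n (s : 'S_n), linear (fun v => ract v s);
  lact1 : forall n (v : db_sort n), lact 1%g v = v;
  ract1 : forall n (v : db_sort n), ract v 1%g = v;
  lactM : forall n (s t : 'S_n) v, lact (perm_comp s t) v = lact s (lact t v);
  ractM : forall n (s t : 'S_n) v, ract v (perm_comp s t) = ract (ract v s) t;
  lract : forall n (s t : 'S_n) v, lact s (ract v t) = ract (lact s v) t
}.

Definition is_bimodule_morphism (S S' : diag_bimodule) (f : forall n, S n -> S' n) :=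
  [/\ forall n, linear (@f n),
      forall n (s : 'S_n) v, f n (lact s v) = lact s (f n v)
    & forall n (s : 'S_n) v, f n (ract v s) = ract (f n v) s].

(* contr j i : S(n+1) -> S(n) contracts the output j with the input i; all     *)
(* indices are numbered from 0.                                                *)
Record wheelspace := Wheelspace {
  ws_bimodule :> diag_bimodule;
  contr : forall n, 'I_n.+1 -> 'I_n.+1 -> ws_bimodule n.+1 -> ws_bimodule n;
  contr_linear : forall n (j i : 'I_n.+1), linear (contr j i);
  contr_act : forall n (j i : 'I_n.+1) (s t : 'S_n.+1) (v : ws_bimodule n.+1),
    contr j i (ract (lact s v) t) =
    ract (lact (ldel j s) (contr ((s^-1)%g j) (t i) v)) (rdel i t);
  contr_contr : forall n (j i : 'I_n.+1) (l h : 'I_n.+2) (v : ws_bimodule n.+2),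
    contr j i (contr l h v) =
    contr (swap_inner j l) (swap_inner i h)
      (contr (swap_outer j l) (swap_outer i h) v)
}.

Definition is_wheelspace_morphism (S S' : wheelspace) (f : forall n, S n -> S' n) :=
  is_bimodule_morphism f /\
  forall n (j i : 'I_n.+1) v, f n (contr j i v) = contr j i (f n.+1 v).

Definition degcast (S : nat -> lmodType k) n m (e : n = m) (v : S n) : S m :=
  eq_rect n S v m e.

Record wheelgebra := Wheelgebra {
  wa_wheelspace :> wheelspace;
  wmul : forall n m, wa_wheelspace n -> wa_wheelspace m -> wa_wheelspace (n + m)%N;
  wone : wa_wheelspace 0%N;
  wmul_bilinear : forall n m, bilinear (@wmul n m);
  wmul_lact : forall n m (s : 'S_n) (t : 'S_m) a b,
    wmul (lact s a) (lact t b) = lact (perm_block s t) (wmul a b);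
  wmul_ract : forall n m (s : 'S_n) (t : 'S_m) a b,
    wmul (ract a s) (ract b t) = ract (wmul a b) (perm_block s t);
  wmulA : forall n m p (a : wa_wheelspace n) (b : wa_wheelspace m)
    (c : wa_wheelspace p),
    degcast (addnA n m p) (wmul a (wmul b c)) = wmul (wmul a b) c;
  wmul1l : forall n (a : wa_wheelspace n), wmul wone a = a;
  wmul1r : forall n (a : wa_wheelspace n), degcast (addn0 n) (wmul a wone) = a;
  contr_mull : forall n m (j i : 'I_n.+1) (a : wa_wheelspace n.+1)
    (b : wa_wheelspace m),
    @contr wa_wheelspace (n + m)%N (lshift m j) (lshift m i) (wmul a b) =
    wmul (contr j i a) b;
  contr_mulr : forall n m (j i : 'I_m.+1) (a : wa_wheelspace n)
    (b : wa_wheelspace m.+1),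
    contr (cast_ord (addnS n m) (rshift n j)) (cast_ord (addnS n m) (rshift n i))
      (degcast (addnS n m) (wmul a b)) =
    wmul a (contr j i b)
}.

Definition is_wheelgebra_morphism (A B : wheelgebra) (f : forall n, A n -> B n) :=
  [/\ is_wheelspace_morphism f,
      forall n m (a : A n) (b : A m), f (n + m)%N (wmul a b) = wmul (f n a) (f m b)
    & f 0%N (wone A) = wone B].

Record wheelgebra_hom (A B : wheelgebra) := WheelgebraHom {
  whom :> forall n, A n -> B n;
  whom_morphism : is_wheelgebra_morphism whom
}.

Lemma wheelgebra_hom_ext (A B : wheelgebra) (f g : wheelgebra_hom A B) :
  (forall n, f n =1 g n) -> f = g.
Proof.
case: f => f fP; case: g => g gP /= fg.
have e : f = g by apply: functional_extensionality_dep => n; apply/funext/fg.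
by subst g; rewrite (Prop_irrelevance fP gP).
Qed.
End Wheels.

Section TensorMap.
Variable k : fieldType.

Lemma tensor_map_bilinear (U U' W W' : lmodType k) (f : {linear U -> U'})
    (g : {linear W -> W'}) : bilinear (fun u w => tens (f u) (g w)).
Proof.
by split=> [w a u u' | u a w w']; rewrite linearP;
  [apply: (tens_bilinear _ _).1 | apply: (tens_bilinear _ _).2].
Qed.

Definition tensor_map (U U' W W' : lmodType k) (f : {linear U -> U'})
    (g : {linear W -> W'}) : {linear tensor U W -> tensor U' W'} :=
  mklinear (tlift_linear (tensor_map_bilinear f g)).

Lemma tensor_mapE (U U' W W' : lmodType k) (f : {linear U -> U'})
  (g : {linear W -> W'}) u w : tensor_map f g (tens u w) = tens (f u) (g w).
Proof. exact: (tliftE _ _ (tensor_map_bilinear f g)). Qed.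

Lemma tensor_ext (U W Z : lmodType k) (f g : {linear tensor U W -> Z}) :
  (forall u w, f (tens u w) = g (tens u w)) -> f =1 g.
Proof. by apply: tensor_linear_ext; exact: linear_linear. Qed.

Lemma sandwich_linear (A B C D : lmodType k) (P : {linear C -> D})
    (Q : {linear A -> B}) :
  linear (fun f : {linear B -> C} => P \o f \o Q : {linear A -> D}).
Proof. by move=> a f g; apply: linear_ext => x /=; rewrite linearP. Qed.
Definition sandwich (A B C D : lmodType k) (P : {linear C -> D})
    (Q : {linear A -> B}) : {linear {linear B -> C} -> {linear A -> D}} :=
  mklinear (sandwich_linear P Q).
End TensorMap.

Section EV.
Variables (k : fieldType) (V : vectType k).
Local Notation T n := (tpow V n).
Local Notation End n := {linear T n -> T n}.

Definition basis_vec (al : 'I_(\dim {:V})) : V := (vbasis {:V})`_al.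
Definition dual_vec (al : 'I_(\dim {:V})) : {linear V -> k^o} :=
  coord (vbasis {:V}) al.

Lemma basis_dual (v : V) : v = \sum_al (dual_vec al v : k) *: basis_vec al.
Proof. exact: (coord_vbasis (memvf v)). Qed.

(* The partial trace f |-> \sum_al (id (x) e_al^* (x) id) f (id (x) e_al (x) id),  *)
(* with e_al^* in position j and e_al in position i.                           *)
Definition ptrace n (j i : 'I_n.+1) : {linear End n.+1 -> End n} :=
  \sum_al sandwich (con_op j (dual_vec al)) (ins_op i (basis_vec al)).

Lemma ptraceE n (j i : 'I_n.+1) (f : End n.+1) x :
  ptrace j i f x = \sum_al con_op j (dual_vec al) (f (ins_op i (basis_vec al) x)).
Proof. by rewrite /ptrace !sumLE. Qed.

Lemma perm_op1 n : perm_op V (1%g : 'S_n) = idfun.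
Proof.
apply: tpow_ext => v; rewrite perm_opE; congr tprod; apply/ffunP => j.
by rewrite ffunE invg1 perm1.
Qed.

Lemma perm_opM n (s t : 'S_n) :
  perm_op V (perm_comp s t) = perm_op V s \o perm_op V t.
Proof.
apply: tpow_ext => v; rewrite compLE !perm_opE; congr tprod; apply/ffunP => j.
by rewrite !ffunE /perm_comp invMg permM.
Qed.

Lemma con_perm n (j : 'I_n.+1) (s : 'S_n.+1) xi (x : T n.+1) :
  con_op j xi (perm_op V s x) = perm_op V (ldel j s) (con_op ((s^-1)%g j) xi x).
Proof.
move: x; apply: tpow_linear_ext.
- by move=> a x y; rewrite !linearP.
- by move=> a x y; rewrite !linearP.
move=> v; rewrite perm_opE !con_opE linearZZ perm_opE !ffunE.
congr (_ *: tprod _); apply/ffunP => m; rewrite !ffunE.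
by rewrite /ldel invgK lift_rdel.
Qed.

Lemma perm_ins n (i : 'I_n.+1) (t : 'S_n.+1) e (x : T n) :
  perm_op V t (ins_op i e x) = ins_op (t i) e (perm_op V (rdel i t) x).
Proof.
move: x; apply: tpow_linear_ext.
- by move=> a x y; rewrite !linearP.
- by move=> a x y; rewrite !linearP.
move=> v; rewrite ins_opE !perm_opE ins_opE; congr tprod.
apply/ffunP => m; rewrite !ffunE; case: (unliftP (t i) m) => [m' ->|->].
  rewrite ffunE.
  have -> : (t^-1)%g (lift (t i) m') = lift i (((rdel i t)^-1)%g m').
    by apply: (@perm_inj _ t); rewrite permKV -lift_rdel permKV.
  by rewrite liftK.
by rewrite permK unlift_none.
Qed.

Lemma swap_outerE n (i : 'I_n.+1) (l : 'I_n.+2) :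
  swap_outer i l = (if (i < l)%N then nat_of_ord i else i.+1) :> nat.
Proof.
rewrite /swap_outer; have li := ltn_ord i; have ll := ltn_ord l.
by case: ltnP => il; rewrite inordK; lia.
Qed.

Lemma swap_innerE n (i : 'I_n.+1) (l : 'I_n.+2) :
  swap_inner i l = (if (i < l)%N then l.-1 else nat_of_ord l) :> nat.
Proof.
rewrite /swap_inner; have li := ltn_ord i; have ll := ltn_ord l.
by case: ltnP => il; rewrite inordK; lia.
Qed.

Lemma swap_lift n (i : 'I_n.+1) (l : 'I_n.+2) :
  swap_outer i l = lift l i /\ lift (swap_outer i l) (swap_inner i l) = l.
Proof.
split; apply: val_inj; rewrite /= swap_outerE ?swap_innerE /bump; case: ltnP; lia.
Qed.

Lemma lift_lift_swap n (i : 'I_n.+1) (l : 'I_n.+2) (m : 'I_n) :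
  lift (swap_outer i l) (lift (swap_inner i l) m) = lift l (lift i m).
Proof.
apply: val_inj; rewrite /= swap_outerE swap_innerE /bump; case: ltnP; lia.
Qed.

Lemma con_con n (j : 'I_n.+1) (l : 'I_n.+2) xi zeta (x : T n.+2) :
  con_op j xi (con_op l zeta x) =
  con_op (swap_inner j l) zeta (con_op (swap_outer j l) xi x).
Proof.
move: x; apply: tpow_linear_ext.
- by move=> a x y; rewrite !linearP.
- by move=> a x y; rewrite !linearP.
move=> v; rewrite !con_opE !linearZZ !con_opE !ffunE.
have [e1 e2] := swap_lift j l.
rewrite !scalerA e2 e1 mulrC; congr (_ *: tprod _); apply/ffunP => m.
by rewrite !ffunE -e1 lift_lift_swap.
Qed.

Lemma ins_ins n (i : 'I_n.+1) (h : 'I_n.+2) e e' (x : T n) :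
  ins_op h e' (ins_op i e x) =
  ins_op (swap_outer i h) e (ins_op (swap_inner i h) e' x).
Proof.
move: x; apply: tpow_linear_ext.
- by move=> a x y; rewrite !linearP.
- by move=> a x y; rewrite !linearP.
move=> v; rewrite !ins_opE; congr tprod; apply/ffunP => m; rewrite !ffunE.
have [e1 e2] := swap_lift i h.
case: (unliftP h m) => [m' ->|->].
  rewrite ffunE; case: (unliftP i m') => [m'' ->|->].
    by rewrite -lift_lift_swap liftK ffunE liftK.
  by rewrite -e1 unlift_none.
by rewrite -{2}e2 liftK ffunE unlift_none.
Qed.

Section Carrier.
Variable B : pzAlgType k.

Definition EV_sort (n : nat) : lmodType k := tensor (End n) B.

Definition EV_lact n (s : 'S_n) : EV_sort n -> EV_sort n :=
  tensor_map (sandwich (perm_op V s) idfun) idfun.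
Definition EV_ract n (v : EV_sort n) (s : 'S_n) : EV_sort n :=
  tensor_map (sandwich idfun (perm_op V s)) idfun v.
Definition EV_contr n (j i : 'I_n.+1) : EV_sort n.+1 -> EV_sort n :=
  tensor_map (ptrace j i) idfun.

Lemma EV_lactE n (s : 'S_n) (f : End n) b :
  EV_lact s (tens f b) = tens (perm_op V s \o f : End n) b.
Proof. by rewrite /EV_lact tensor_mapE; congr tens; apply: linear_ext. Qed.
Lemma EV_ractE n (s : 'S_n) (f : End n) b :
  EV_ract (tens f b) s = tens (f \o perm_op V s : End n) b.
Proof. by rewrite /EV_ract tensor_mapE; congr tens; apply: linear_ext. Qed.
Lemma EV_contrE n (j i : 'I_n.+1) (f : End n.+1) b :
  EV_contr j i (tens f b) = tens (ptrace j i f) b.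
Proof. exact: tensor_mapE. Qed.

Lemma EV_lact_linear n (s : 'S_n) : linear (EV_lact s).
Proof. exact: (linear_linear (tensor_map _ _)). Qed.
Lemma EV_ract_linear n (s : 'S_n) : linear (fun v => EV_ract v s).
Proof. exact: (linear_linear (tensor_map _ _)). Qed.
Lemma EV_contr_linear n (j i : 'I_n.+1) : linear (EV_contr j i).
Proof. exact: (linear_linear (tensor_map _ _)). Qed.

Lemma EV_lact1 n (v : EV_sort n) : EV_lact 1%g v = v.
Proof.
move: v; apply: tensor_linear_ext; [exact: EV_lact_linear|by []|].
by move=> f b; rewrite EV_lactE perm_op1; congr tens; apply: linear_ext.
Qed.
Lemma EV_ract1 n (v : EV_sort n) : EV_ract v 1%g = v.
Proof.
move: v; apply: tensor_linear_ext; [exact: EV_ract_linear|by []|].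
by move=> f b; rewrite EV_ractE perm_op1; congr tens; apply: linear_ext.
Qed.
Lemma EV_lactM n (s t : 'S_n) v :
  EV_lact (perm_comp s t) v = EV_lact s (EV_lact t v).
Proof.
move: v; apply: tensor_linear_ext; [exact: EV_lact_linear| |].
  exact: lin_comp (@EV_lact_linear n s) (@EV_lact_linear n t).
by move=> f b; rewrite !EV_lactE perm_opM; congr tens; apply: linear_ext.
Qed.
Lemma EV_ractM n (s t : 'S_n) v :
  EV_ract v (perm_comp s t) = EV_ract (EV_ract v s) t.
Proof.
move: v; apply: tensor_linear_ext; [exact: EV_ract_linear| |].
  exact: lin_comp (@EV_ract_linear n t) (@EV_ract_linear n s).
by move=> f b; rewrite !EV_ractE perm_opM; congr tens; apply: linear_ext.
Qed.
Lemma EV_lract n (s t : 'S_n) v :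
  EV_lact s (EV_ract v t) = EV_ract (EV_lact s v) t.
Proof.
move: v; apply: tensor_linear_ext.
- exact: lin_comp (@EV_lact_linear n s) (@EV_ract_linear n t).
- exact: lin_comp (@EV_ract_linear n t) (@EV_lact_linear n s).
move=> f b; rewrite EV_ractE !EV_lactE EV_ractE; congr tens; exact: linear_ext.
Qed.

Definition EV_bimodule : diag_bimodule k :=
  DiagBimodule EV_lact_linear EV_ract_linear EV_lact1 EV_ract1
    EV_lactM EV_ractM EV_lract.

Lemma EV_contr_act n (j i : 'I_n.+1) (s t : 'S_n.+1) (v : EV_sort n.+1) :
  EV_contr j i (EV_ract (EV_lact s v) t) =
  EV_ract (EV_lact (ldel j s) (EV_contr ((s^-1)%g j) (t i) v)) (rdel i t).
Proof.
move: v; apply: tensor_linear_ext.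
- exact: lin_comp (EV_contr_linear j i) (lin_comp (@EV_ract_linear n.+1 t) (@EV_lact_linear n.+1 s)).
- exact: lin_comp (@EV_ract_linear n _) (lin_comp (@EV_lact_linear n _) (EV_contr_linear _ _)).
move=> f b; rewrite EV_lactE EV_ractE !EV_contrE EV_lactE EV_ractE.
congr tens; apply: linear_ext => x; rewrite ptraceE !compLE ptraceE linear_sum.
by apply: eq_bigr => al _; rewrite !compLE con_perm perm_ins.
Qed.

Lemma EV_contr_contr n (j i : 'I_n.+1) (l h : 'I_n.+2) (v : EV_sort n.+2) :
  EV_contr j i (EV_contr l h v) =
  EV_contr (swap_inner j l) (swap_inner i h)
    (EV_contr (swap_outer j l) (swap_outer i h) v).
Proof.
move: v; apply: tensor_linear_ext.
- exact: lin_comp (EV_contr_linear _ _) (EV_contr_linear _ _).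
- exact: lin_comp (EV_contr_linear _ _) (EV_contr_linear _ _).
move=> f b; rewrite !EV_contrE; congr tens; apply: linear_ext => x.
rewrite !ptraceE.
under eq_bigr => al _ do rewrite ptraceE linear_sum.
under [RHS]eq_bigr => al _ do rewrite ptraceE linear_sum.
rewrite [RHS]exchange_big; apply: eq_bigr => al _; apply: eq_bigr => be _.
by rewrite con_con ins_ins.
Qed.

Definition EV_wheelspace : wheelspace k :=
  @Wheelspace k EV_bimodule EV_contr EV_contr_linear EV_contr_act EV_contr_contr.

Section Mul.
Variables n m : nat.

Definition EV_mul_aux (f : End n) (b : B) : EV_sort m -> EV_sort (n + m) :=
  @tlift k (End m) B (EV_sort (n + m)) (fun g b' => tens (tens_op f g) (b * b')).
Definition EV_mul (x : EV_sort n) (y : EV_sort m) : EV_sort (n + m) :=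
  @tlift k (End n) B (EV_sort (n + m)) (fun f b => EV_mul_aux f b y) x.

Lemma tens_op_bilinear : bilinear (@tens_op k V n m).
Proof.
split=> [g a f f' | f a g g']; apply: tcat_ext => v w.
  rewrite [RHS]addLE [X in _ = X + _]scaleLE !tens_opE.
  exact: (tcat_bilinear _ _ _).1.
rewrite [RHS]addLE [X in _ = X + _]scaleLE !tens_opE.
exact: (tcat_bilinear _ _ _).2.
Qed.

Lemma mul_bilinear : bilinear (fun b b' : B => b * b').
Proof.
split=> [c a x y | c a x y]; first by rewrite mulrDl pzscalerAl.
by rewrite mulrDr pzscalerAr.
Qed.

Let tb := tens_bilinear (End (n + m)) B.

Let aux_bil (f : End n) (b : B) :
  bilinear (fun (g : End m) (b' : B) => tens (tens_op f g) (b * b')).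
Proof.
split=> [b' | g].
  exact: lin_comp (tb.1 (b * b')) (tens_op_bilinear.2 f).
exact: lin_comp (tb.2 (tens_op f g)) (mul_bilinear.2 b).
Qed.

Let aux_linear f b : linear (EV_mul_aux f b).
Proof. exact: (tlift_linear (aux_bil f b)). Qed.
Let auxE f b g b' : EV_mul_aux f b (tens g b') = tens (tens_op f g) (b * b').
Proof. exact: (tliftE _ _ (aux_bil f b)). Qed.

Let mul_bil y : bilinear (fun (f : End n) (b : B) => EV_mul_aux f b y).
Proof.
split=> [b a f f' | f a b b']; move: y; apply: tensor_linear_ext.
- exact: aux_linear.
- exact: lin_comb (aux_linear f b) (aux_linear f' b).
- by move=> g b'; rewrite !auxE tens_op_bilinear.1 tb.1.
- exact: aux_linear.
- exact: lin_comb (aux_linear f b) (aux_linear f b').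
- by move=> g c; rewrite !auxE mul_bilinear.1 tb.2.
Qed.

Lemma EV_mulE (f : End n) (b : B) (g : End m) (b' : B) :
  EV_mul (tens f b) (tens g b') = tens (tens_op f g) (b * b').
Proof. by rewrite /EV_mul (tliftE _ _ (mul_bil _)) auxE. Qed.

Lemma EV_mul_bilinear : bilinear EV_mul.
Proof.
have hl y : linear (EV_mul^~ y) by exact: (tlift_linear (mul_bil y)).
split=> [y | x a y y']; first exact: hl.
move: x; apply: tensor_linear_ext; [exact: hl | exact: lin_comb (hl y) (hl y') |].
move=> f b; rewrite /EV_mul !(tliftE _ _ (mul_bil _)).
exact: aux_linear.
Qed.
End Mul.
End Carrier.
End EV.

Section ConcatTheory.
Variables (k : fieldType) (V : lmodType k).
Local Notation T n := (tpow V n).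
Local Notation End n := {linear T n -> T n}.

Definition tcast n m (e : n = m) (x : T n) : T m := eq_rect n (fun p => T p) x m e.
Definition endcast n m (e : n = m) (f : End n) : End m :=
  eq_rect n (fun p => End p) f m e.

Lemma tcast_linear n m (e : n = m) : linear (tcast e).
Proof. by case: m / e. Qed.
Lemma tcast_tprod n m (e : n = m) v :
  tcast e (tprod v) = tprod [ffun j => v (cast_ord (esym e) j)].
Proof.
case: m / e; congr tprod; apply/ffunP => j.
by rewrite ffunE; congr (v _); apply: val_inj.
Qed.
Lemma endcastE n m (e : n = m) f x : endcast e f (tcast e x) = tcast e (f x).
Proof. by case: m / e. Qed.

Lemma tcatA n m p (x : T n) (y : T m) (z : T p) :
  tcast (addnA n m p) (tcat x (tcat y z)) = tcat (tcat x y) z.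
Proof.
move: x; apply: tpow_linear_ext.
- exact: lin_comp (tcast_linear _) ((tcat_bilinear _ _ _).1 _).
- exact: lin_comp ((tcat_bilinear _ _ _).1 _) ((tcat_bilinear _ _ _).1 _).
move=> u; move: y; apply: tpow_linear_ext.
- exact: lin_comp (tcast_linear _) (lin_comp ((tcat_bilinear _ _ _).2 _)
    ((tcat_bilinear _ _ _).1 _)).
- exact: lin_comp ((tcat_bilinear _ _ _).1 _) ((tcat_bilinear _ _ _).2 _).
move=> v; move: z; apply: tpow_linear_ext.
- exact: lin_comp (tcast_linear _) (lin_comp ((tcat_bilinear _ _ _).2 _)
    ((tcat_bilinear _ _ _).2 _)).
- exact: (tcat_bilinear _ _ _).2.
move=> w; rewrite !tcatE tcast_tprod; congr tprod; apply/ffunP => j.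
rewrite ffunE; case: (split_ordP j) => [j' ->|c ->].
  case: (split_ordP j') => [a ->|b ->]; rewrite !cat_tuple_lshift.
    have -> : cast_ord (esym (addnA n m p)) (lshift p (lshift m a)) =
      lshift (m + p) a by apply: val_inj.
    by rewrite cat_tuple_lshift.
  have -> : cast_ord (esym (addnA n m p)) (lshift p (rshift n b)) =
    rshift n (lshift p b) by apply: val_inj.
  by rewrite !cat_tuple_rshift cat_tuple_lshift.
have -> : cast_ord (esym (addnA n m p)) (rshift (n + m) c) =
  rshift n (rshift m c) by apply: val_inj; rewrite /= addnA.
by rewrite !cat_tuple_rshift.
Qed.

Lemma tcat0l n (v : {ffun 'I_0 -> V}) (x : T n) : tcat (tprod v) x = x.
Proof.
move: x; apply: tpow_linear_ext; [exact: (tcat_bilinear _ _ _).2|by []|].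
move=> w; rewrite tcatE; congr tprod; apply/ffunP => j.
have -> : j = rshift 0 j by apply: val_inj.
by rewrite cat_tuple_rshift; congr (w _); apply: val_inj.
Qed.

Lemma tcat0r n (v : {ffun 'I_0 -> V}) (x : T n) :
  tcast (addn0 n) (tcat x (tprod v)) = x.
Proof.
move: x; apply: tpow_linear_ext; [|by []|].
  exact: lin_comp (tcast_linear _) ((tcat_bilinear _ _ _).1 _).
move=> w; rewrite tcatE tcast_tprod; congr tprod; apply/ffunP => j.
rewrite ffunE.
have -> : cast_ord (esym (addn0 n)) j = lshift 0 j by apply: val_inj.
by rewrite cat_tuple_lshift.
Qed.

Lemma perm_tcat n m (s : 'S_n) (t : 'S_m) (x : T n) (y : T m) :
  perm_op V (perm_block s t) (tcat x y) = tcat (perm_op V s x) (perm_op V t y).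
Proof.
move: x y; apply: tpow_bilinear_ext.
- split=> [y | x].
    exact: lin_comp (linear_linear _) ((tcat_bilinear _ _ _).1 _).
  exact: lin_comp (linear_linear _) ((tcat_bilinear _ _ _).2 _).
- split=> [y | x].
    exact: lin_comp ((tcat_bilinear _ _ _).1 _) (linear_linear _).
  exact: lin_comp ((tcat_bilinear _ _ _).2 _) (linear_linear _).
move=> v w; rewrite tcatE !perm_opE tcatE; congr tprod; apply/ffunP => j.
rewrite [LHS]ffunE; case: (split_ordP j) => a ->.
  have -> : ((perm_block s t)^-1)%g (lshift m a) = lshift m ((s^-1)%g a).
    by apply: (@perm_inj _ (perm_block s t)); rewrite permKV perm_block_lshift permKV.
  by rewrite !cat_tuple_lshift ffunE.
have -> : ((perm_block s t)^-1)%g (rshift n a) = rshift n ((t^-1)%g a).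
  by apply: (@perm_inj _ (perm_block s t)); rewrite permKV perm_block_rshift permKV.
by rewrite !cat_tuple_rshift ffunE.
Qed.

Lemma lift_lshift n m (i : 'I_n.+1) (a : 'I_n) :
  lshift m (lift i a) = @lift (n + m).+1 (lshift m i) (lshift m a).
Proof. exact: val_inj. Qed.
Lemma lift_lrshift n m (i : 'I_n.+1) (b : 'I_m) :
  rshift n.+1 b = @lift (n + m).+1 (lshift m i) (rshift n b).
Proof.
by apply: val_inj; have := ltn_ord i; rewrite /= /bump; case: leqP => //=; lia.
Qed.
Lemma lift_rshift n m (i : 'I_m.+1) (b : 'I_m) :
  cast_ord (addnS n m) (rshift n (lift i b)) =
  lift (cast_ord (addnS n m) (rshift n i)) (rshift n b).
Proof. by apply: val_inj; rewrite /= /bump; lia. Qed.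
Lemma lift_rlshift n m (i : 'I_m.+1) (a : 'I_n) :
  cast_ord (addnS n m) (lshift m.+1 a) =
  lift (cast_ord (addnS n m) (rshift n i)) (lshift m a).
Proof. by apply: val_inj; have := ltn_ord a; rewrite /= /bump; lia. Qed.

Lemma ins_tcat_l n m (i : 'I_n.+1) e (x : T n) (y : T m) :
  @ins_op k V (n + m) (lshift m i) e (tcat x y) = tcat (ins_op i e x) y.
Proof.
move: x y; apply: tpow_bilinear_ext.
- split=> [y | x].
    exact: lin_comp (linear_linear _) ((tcat_bilinear _ _ _).1 _).
  exact: lin_comp (linear_linear _) ((tcat_bilinear _ _ _).2 _).
- split=> [y | x]; last exact: ((tcat_bilinear V n.+1 m).2 _).
  exact: lin_comp ((tcat_bilinear V n.+1 m).1 _) (linear_linear _).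
move=> v w; rewrite tcatE !ins_opE tcatE; congr tprod; apply/ffunP => j.
rewrite [LHS]ffunE; case: (@split_ordP n.+1 m j) => a ->.
  rewrite (@cat_tuple_lshift k V n.+1 m) ffunE; case: (unliftP i a) => [a' ->|->].
    by rewrite lift_lshift liftK cat_tuple_lshift.
  by rewrite unlift_none.
by rewrite (@cat_tuple_rshift k V n.+1 m) (lift_lrshift i) liftK cat_tuple_rshift.
Qed.

Lemma ins_tcat_r n m (i : 'I_m.+1) e (x : T n) (y : T m) :
  ins_op (cast_ord (addnS n m) (rshift n i)) e (tcat x y) =
  tcast (addnS n m) (tcat x (ins_op i e y)).
Proof.
move: x y; apply: tpow_bilinear_ext.
- split=> [y | x].
    exact: lin_comp (linear_linear _) ((tcat_bilinear _ _ _).1 _).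
  exact: lin_comp (linear_linear _) ((tcat_bilinear _ _ _).2 _).
- split=> [y | x].
    exact: lin_comp (tcast_linear _) ((tcat_bilinear _ _ _).1 _).
  exact: lin_comp (tcast_linear _)
    (lin_comp ((tcat_bilinear _ _ _).2 _) (linear_linear _)).
move=> v w; rewrite tcatE !ins_opE tcatE tcast_tprod; congr tprod.
apply/ffunP => j; rewrite [LHS]ffunE [RHS]ffunE.
have [j' ->] : exists j', j = cast_ord (addnS n m) j'.
  by exists (cast_ord (esym (addnS n m)) j); apply: val_inj.
rewrite cast_ordK; case: (split_ordP j') => a ->.
  by rewrite (lift_rlshift i) liftK !cat_tuple_lshift.
rewrite cat_tuple_rshift ffunE; case: (unliftP i a) => [a' ->|->].
  by rewrite lift_rshift liftK cat_tuple_rshift.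
by rewrite unlift_none.
Qed.

Lemma con_tcat_l n m (j : 'I_n.+1) xi (x : T n.+1) (y : T m) :
  @con_op k V (n + m) (lshift m j) xi (tcat x y) = tcat (con_op j xi x) y.
Proof.
move: x y; apply: tpow_bilinear_ext.
- split=> [y | x].
    exact: lin_comp (linear_linear _) ((tcat_bilinear V n.+1 m).1 _).
  exact: lin_comp (linear_linear _) ((tcat_bilinear V n.+1 m).2 _).
- split=> [y | x]; last exact: ((tcat_bilinear _ _ _).2 _).
  exact: lin_comp ((tcat_bilinear _ _ _).1 _) (linear_linear _).
move=> v w; rewrite tcatE !con_opE (tcat_bilinearZl _) tcatE (@cat_tuple_lshift k V n.+1 m).
congr (_ *: tprod _); apply/ffunP => a; rewrite ffunE.
case: (split_ordP a) => b ->.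
  by rewrite cat_tuple_lshift [RHS]ffunE -lift_lshift (@cat_tuple_lshift k V n.+1 m).
by rewrite -lift_lrshift (@cat_tuple_rshift k V n.+1 m) cat_tuple_rshift.
Qed.

Lemma con_tcat_r n m (j : 'I_m.+1) xi (x : T n) (y : T m.+1) :
  con_op (cast_ord (addnS n m) (rshift n j)) xi (tcast (addnS n m) (tcat x y)) =
  tcat x (con_op j xi y).
Proof.
move: x y; apply: tpow_bilinear_ext.
- split=> [y | x].
    exact: lin_comp (linear_linear _)
      (lin_comp (tcast_linear _) ((tcat_bilinear _ _ _).1 _)).
  exact: lin_comp (linear_linear _)
    (lin_comp (tcast_linear _) ((tcat_bilinear _ _ _).2 _)).
- split=> [y | x]; first exact: ((tcat_bilinear _ _ _).1 _).
  exact: lin_comp ((tcat_bilinear _ _ _).2 _) (linear_linear _).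
move=> v w; rewrite tcatE tcast_tprod !con_opE (tcat_bilinearZr _) tcatE.
rewrite [X in xi X]ffunE cast_ordK cat_tuple_rshift.
congr (_ *: tprod _); apply/ffunP => a; rewrite [LHS]ffunE [LHS]ffunE.
case: (split_ordP a) => b ->.
  by rewrite -lift_rlshift cast_ordK !cat_tuple_lshift.
by rewrite -lift_rshift cast_ordK !cat_tuple_rshift [RHS]ffunE.
Qed.
End ConcatTheory.

Section EVAlgebra.
Variables (k : fieldType) (V : vectType k).
Local Notation T n := (tpow V n).
Local Notation End n := {linear T n -> T n}.

Section Carrier.
Variable B : pzAlgType k.
Local Notation E := (EV_sort V B).

Definition EV_one : E 0%N := tens (idfun : End 0%N) (1 : B).

Lemma bil_ext n m (Z : lmodType k) (f g : E n -> E m -> Z) :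
  bilinear f -> bilinear g ->
  (forall u w u' w', f (tens u w) (tens u' w') = g (tens u w) (tens u' w')) ->
  forall x y, f x y = g x y.
Proof. exact: bilinear_ext2. Qed.

Let mul_l n m (y : E m) : linear ((@EV_mul k V B n m)^~ y).
Proof. exact: (EV_mul_bilinear V B n m).1. Qed.
Let mul_r n m (x : E n) : linear (@EV_mul k V B n m x).
Proof. exact: (EV_mul_bilinear V B n m).2. Qed.

Lemma EV_mul_lact n m (s : 'S_n) (t : 'S_m) (a : E n) (b : E m) :
  EV_mul (EV_lact s a) (EV_lact t b) = EV_lact (perm_block s t) (EV_mul a b).
Proof.
move: a b; apply: bil_ext.
- split=> [y | x].
    exact: (lin_comp (@mul_l n m (EV_lact t y)) (@EV_lact_linear k V B n s)).
  exact: (lin_comp (@mul_r n m (EV_lact s x)) (@EV_lact_linear k V B m t)).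
- split=> [y | x].
    exact: (lin_comp (EV_lact_linear (perm_block s t)) (@mul_l n m y)).
  exact: (lin_comp (EV_lact_linear (perm_block s t)) (@mul_r n m x)).
move=> f b g b'; rewrite !EV_lactE !EV_mulE EV_lactE; congr tens.
by apply: tcat_ext => v w; rewrite tens_opE !compLE tens_opE perm_tcat.
Qed.

Lemma EV_mul_ract n m (s : 'S_n) (t : 'S_m) (a : E n) (b : E m) :
  EV_mul (EV_ract a s) (EV_ract b t) = EV_ract (EV_mul a b) (perm_block s t).
Proof.
move: a b; apply: bil_ext.
- split=> [y | x].
    exact: (lin_comp (@mul_l n m (EV_ract y t)) (@EV_ract_linear k V B n s)).
  exact: (lin_comp (@mul_r n m (EV_ract x s)) (@EV_ract_linear k V B m t)).
- split=> [y | x].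
    exact: (lin_comp (EV_ract_linear (perm_block s t)) (@mul_l n m y)).
  exact: (lin_comp (EV_ract_linear (perm_block s t)) (@mul_r n m x)).
move=> f b g b'; rewrite !EV_ractE !EV_mulE EV_ractE; congr tens.
by apply: tcat_ext => v w; rewrite tens_opE !compLE perm_tcat tens_opE.
Qed.

Let degcast_linear n m (e : n = m) : linear (@degcast k E n m e).
Proof. by case: m / e. Qed.
Let degcastE n m (e : n = m) (f : End n) (b : B) :
  @degcast k E n m e (tens f b) = tens (endcast e f) b.
Proof. by case: m / e. Qed.

Lemma EV_mulA n m p (a : E n) (b : E m) (c : E p) :
  @degcast k E _ _ (addnA n m p) (EV_mul a (EV_mul b c)) = EV_mul (EV_mul a b) c.
Proof.
move: a; apply: tensor_linear_ext.
- exact: (lin_comp (degcast_linear _) (@mul_l _ _ _)).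
- exact: (lin_comp (@mul_l _ _ c) (@mul_l _ _ b)).
move=> f a; move: b; apply: tensor_linear_ext.
- exact: (lin_comp (degcast_linear _) (lin_comp (@mul_r _ _ _) (@mul_l _ _ c))).
- exact: (lin_comp (@mul_l _ _ c) (@mul_r _ _ _)).
move=> g b; move: c; apply: tensor_linear_ext.
- exact: (lin_comp (degcast_linear _) (lin_comp (@mul_r _ _ _) (@mul_r _ _ _))).
- exact: (@mul_r _ _ _).
move=> h c; rewrite !EV_mulE degcastE mulrA; congr tens.
apply: tcat_ext => v w; rewrite -[v]cat_left_right -tcatE.
by rewrite !tens_opE -tcatA endcastE !tens_opE tcatA.
Qed.

Lemma EV_mul1l n (a : E n) : EV_mul EV_one a = a.
Proof.
move: a; apply: tensor_linear_ext; [exact: (@mul_r _ _ EV_one)|by []|].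
move=> f b; rewrite EV_mulE mul1r.
suff -> : tens_op (idfun : End 0%N) f = f by [].
by apply: tcat_ext => v w; rewrite tens_opE !tcat0l.
Qed.

Lemma EV_mul1r n (a : E n) : @degcast k E _ _ (addn0 n) (EV_mul a EV_one) = a.
Proof.
move: a; apply: tensor_linear_ext; [|by []|].
  exact: (lin_comp (degcast_linear _) (@mul_l _ _ EV_one)).
move=> f b; rewrite EV_mulE degcastE mulr1; congr tens.
apply: tpow_ext => v; pose v0 : {ffun 'I_0 -> V} := [ffun=> 0].
by rewrite -{1}[tprod v](tcat0r v0) endcastE tens_opE tcat0r.
Qed.

Lemma EV_contr_mull n m (j i : 'I_n.+1) (a : E n.+1) (b : E m) :
  @EV_contr k V B (n + m) (lshift m j) (lshift m i) (EV_mul a b) =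
  EV_mul (EV_contr j i a) b.
Proof.
move: a b; apply: bil_ext.
- split=> [y | x].
    exact: (lin_comp (@EV_contr_linear k V B (n + m) _ _) (@mul_l n.+1 m y)).
  exact: (lin_comp (@EV_contr_linear k V B (n + m) _ _) (@mul_r n.+1 m x)).
- split=> [y | x]; last exact: (@mul_r n m _).
  exact: (lin_comp (@mul_l n m y) (@EV_contr_linear k V B n _ _)).
move=> f b g b'; rewrite EV_mulE !EV_contrE EV_mulE; congr tens.
apply: tcat_ext => v w; rewrite tens_opE !ptraceE.
rewrite (big_morph (fun x => tcat x (g (tprod w))) (id1 := 0) (op1 := +%R)).
- apply: eq_bigr => al _.
  by rewrite ins_tcat_l (@tens_opE k V n.+1 m) con_tcat_l.
- by move=> x y; rewrite -[x]scale1r (tcat_bilinear _ _ _).1 !scale1r.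
by rewrite -[0 in LHS](scale0r 0) tcat_bilinearZl scale0r.
Qed.

Lemma EV_contr_mulr n m (j i : 'I_m.+1) (a : E n) (b : E m.+1) :
  EV_contr (cast_ord (addnS n m) (rshift n j)) (cast_ord (addnS n m) (rshift n i))
      (@degcast k E _ _ (addnS n m) (EV_mul a b)) =
  EV_mul a (EV_contr j i b).
Proof.
move: a b; apply: bil_ext.
- split=> [y | x].
    exact: (lin_comp (@EV_contr_linear k V B _ _ _)
      (lin_comp (degcast_linear _) (@mul_l n m.+1 y))).
  exact: (lin_comp (@EV_contr_linear k V B _ _ _)
      (lin_comp (degcast_linear _) (@mul_r n m.+1 x))).
- split=> [y | x]; first exact: (@mul_l n m _).
  exact: (lin_comp (@mul_r n m x) (@EV_contr_linear k V B m _ _)).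
move=> f b g b'; rewrite EV_mulE degcastE !EV_contrE EV_mulE; congr tens.
apply: tcat_ext => v w; rewrite tens_opE !ptraceE.
rewrite (big_morph (tcat (f (tprod v))) (id1 := 0) (op1 := +%R)).
- apply: eq_bigr => al _.
  by rewrite ins_tcat_r endcastE tens_opE con_tcat_r.
- by move=> x y; rewrite -[x]scale1r (tcat_bilinear _ _ _).2 !scale1r.
by rewrite -[0 in LHS](scale0r 0) tcat_bilinearZr scale0r.
Qed.

Definition EV : wheelgebra k :=
  @Wheelgebra k (EV_wheelspace V B) (@EV_mul k V B) EV_one
    (EV_mul_bilinear V B) EV_mul_lact EV_mul_ract EV_mulA EV_mul1l EV_mul1r
    EV_contr_mull EV_contr_mulr.
End Carrier.

Section Functoriality.
Variables (B B' : pzAlgType k) (f : alg_hom B B').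

Definition EV_map n : EV B n -> EV B' n :=
  tensor_map (idfun : {linear End n -> End n}) (mklinear (ahom_linear f)).

Lemma EV_mapE n (g : End n) (b : B) : EV_map (tens g b : EV B n) = tens g (f b).
Proof. exact: tensor_mapE. Qed.

Lemma EV_map_linear n : linear (@EV_map n).
Proof. exact: (linear_linear (tensor_map _ _)). Qed.

Lemma EV_map_morphism : is_wheelgebra_morphism EV_map.
Proof.
split.
- split; first split.
  + exact: EV_map_linear.
  + move=> n s; apply: tensor_linear_ext.
    * exact: (lin_comp (@EV_map_linear n) (@EV_lact_linear k V B n s)).
    * exact: (lin_comp (@EV_lact_linear k V B' n s) (@EV_map_linear n)).
    by move=> g b; rewrite [lact _ _]EV_lactE !EV_mapE [RHS]EV_lactE.
  + move=> n s; apply: tensor_linear_ext.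
    * exact: (lin_comp (@EV_map_linear n) (@EV_ract_linear k V B n s)).
    * exact: (lin_comp (@EV_ract_linear k V B' n s) (@EV_map_linear n)).
    by move=> g b; rewrite [ract _ _]EV_ractE !EV_mapE [RHS]EV_ractE.
  move=> n j i; apply: tensor_linear_ext.
  + exact: (lin_comp (@EV_map_linear n) (@EV_contr_linear k V B n j i)).
  + exact: (lin_comp (@EV_contr_linear k V B' n j i) (@EV_map_linear n.+1)).
  by move=> g b; rewrite [contr _ _ _]EV_contrE !EV_mapE [RHS]EV_contrE.
- move=> n m; apply: bil_ext.
  + split=> [y | x].
      exact: (lin_comp (@EV_map_linear _) ((EV_mul_bilinear V B n m).1 y)).
    exact: (lin_comp (@EV_map_linear _) ((EV_mul_bilinear V B n m).2 x)).
  + split=> [y | x].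
      exact: (lin_comp ((EV_mul_bilinear V B' n m).1 _) (@EV_map_linear _)).
    exact: (lin_comp ((EV_mul_bilinear V B' n m).2 _) (@EV_map_linear _)).
  move=> g b g' b'; rewrite [wmul _ _]EV_mulE !EV_mapE [RHS]EV_mulE.
  by rewrite (ahom_monoid f).2.
by rewrite EV_mapE (ahom_monoid f).1.
Qed.

Definition EV_hom : wheelgebra_hom (EV B) (EV B') := WheelgebraHom EV_map_morphism.
End Functoriality.
End EVAlgebra.

Section Abelianization.
Variables (k : fieldType) (B : pzAlgType k).

Record two_sided_ideal (I : B -> Prop) : Prop := TwoSidedIdeal {
  ideal0 : I 0;
  idealD : forall x y, I x -> I y -> I (x + y);
  idealMl : forall a x, I x -> I (a * x);
  idealMr : forall a x, I x -> I (x * a)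
}.

Definition comm_ideal (x : B) : Prop :=
  forall I, two_sided_ideal I -> (forall a b, I (a * b - b * a)) -> I x.

Lemma comm_idealP : two_sided_ideal comm_ideal.
Proof.
split=> [|x y hx hy|a x hx|a x hx] I hI hc; first exact: (ideal0 hI).
- by apply: (idealD hI); [apply: hx | apply: hy].
- by apply: (idealMl hI); apply: hx.
- by apply: (idealMr hI); apply: hx.
Qed.

Lemma comm_idealC a b : comm_ideal (a * b - b * a).
Proof. by move=> I _; apply. Qed.

Lemma comm_idealN x : comm_ideal x -> comm_ideal (- x).
Proof. by move=> h; rewrite -mulN1r; apply: (idealMl comm_idealP). Qed.

Definition comm_eq (x y : B) : bool := `[< comm_ideal (x - y) >].

Let comm_eq_refl : reflexive comm_eq.
Proof. by move=> x; apply/asboolP; rewrite subrr; apply: (ideal0 comm_idealP). Qed.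
Let comm_eq_sym : symmetric comm_eq.
Proof.
by move=> x y; apply/asboolP/asboolP => h; rewrite -opprB; apply: comm_idealN.
Qed.
Let comm_eq_trans : transitive comm_eq.
Proof.
move=> y x z /asboolP xy /asboolP yz; apply/asboolP.
by rewrite -(subrKA y); apply: (idealD comm_idealP).
Qed.
Canonical comm_equiv := EquivRel comm_eq comm_eq_refl comm_eq_sym comm_eq_trans.

Definition abel := {eq_quot comm_equiv}.
HB.instance Definition _ := Choice.on abel.

Definition abel_pi (x : B) : abel := \pi_({eq_quot comm_equiv}) x.
Let rep (x : abel) : B := repr x.

Lemma abel_piP a b : abel_pi a = abel_pi b <-> comm_ideal (a - b).
Proof. by split=> [/eqmodP/asboolP|h]; last apply/eqmodP/asboolP. Qed.
Lemma abel_reprK (x : abel) : abel_pi (repr x) = x.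
Proof. exact: reprK. Qed.
Lemma abel_ind (P : abel -> Prop) : (forall a, P (abel_pi a)) -> forall x, P x.
Proof. by move=> h x; rewrite -[x]abel_reprK. Qed.

Let rpi a : comm_ideal (repr (abel_pi a) - a).
Proof. by apply/abel_piP; rewrite abel_reprK. Qed.

Let aadd (x y : abel) : abel := abel_pi (rep x + rep y).
Let aopp (x : abel) : abel := abel_pi (- rep x).
Let ascale (c : k) (x : abel) : abel := abel_pi (c *: rep x).
Let mult (x y : abel) : abel := abel_pi (rep x * rep y).

Let piD a b : aadd (abel_pi a) (abel_pi b) = abel_pi (a + b).
Proof.
by apply/abel_piP; rewrite opprD addrACA; apply: (idealD comm_idealP); apply: rpi.
Qed.
Let piN a : aopp (abel_pi a) = abel_pi (- a).
Proof. by apply/abel_piP; rewrite -opprD; apply: comm_idealN; apply: rpi. Qed.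
Let piZ c a : ascale c (abel_pi a) = abel_pi (c *: a).
Proof.
apply/abel_piP; rewrite -scalerBr -[X in _ *: X]mul1r pzscalerAl.
by apply: (idealMl comm_idealP); apply: rpi.
Qed.
Let piM a b : mult (abel_pi a) (abel_pi b) = abel_pi (a * b).
Proof.
apply/abel_piP; rewrite -(subrKA (a * rep (abel_pi b))) -mulrBl -mulrBr.
apply: (idealD comm_idealP).
  by apply: (idealMr comm_idealP); apply: rpi.
by apply: (idealMl comm_idealP); apply: rpi.
Qed.

Let addA : associative aadd.
Proof. by elim/abel_ind=> a; elim/abel_ind=> b; elim/abel_ind=> c; rewrite !piD addrA. Qed.
Let addC : commutative aadd.
Proof. by elim/abel_ind=> a; elim/abel_ind=> b; rewrite !piD addrC. Qed.
Let add0 : left_id (abel_pi 0) aadd.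
Proof. by elim/abel_ind=> a; rewrite piD add0r. Qed.
Let addN : left_inverse (abel_pi 0) aopp aadd.
Proof. by elim/abel_ind=> a; rewrite piN piD addNr. Qed.
HB.instance Definition _ := GRing.isZmodule.Build abel addA addC add0 addN.

Let scaleA a b x : ascale a (ascale b x) = ascale (a * b) x.
Proof. by elim/abel_ind: x => x; rewrite !piZ scalerA. Qed.
Let scale1 : left_id 1 ascale.
Proof. by elim/abel_ind=> x; rewrite piZ scale1r. Qed.
Let scaleDr : right_distributive ascale +%R.
Proof.
by move=> c; elim/abel_ind=> a; elim/abel_ind=> b; rewrite [_ + _]piD !piZ scalerDr [RHS]piD.
Qed.
Let scaleDl x : {morph ascale^~ x : a b / a + b}.
Proof. by elim/abel_ind: x => x a b; rewrite !piZ scalerDl [RHS]piD. Qed.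
HB.instance Definition _ :=
  GRing.Zmodule_isLmodule.Build k abel scaleA scale1 scaleDr scaleDl.

Let multA : associative mult.
Proof. by elim/abel_ind=> a; elim/abel_ind=> b; elim/abel_ind=> c; rewrite !piM mulrA. Qed.
Let mult1l : left_id (abel_pi 1) mult.
Proof. by elim/abel_ind=> a; rewrite piM mul1r. Qed.
Let mult1r : right_id (abel_pi 1) mult.
Proof. by elim/abel_ind=> a; rewrite piM mulr1. Qed.
Let multDl : left_distributive mult +%R.
Proof.
elim/abel_ind=> a; elim/abel_ind=> b; elim/abel_ind=> c.
by rewrite [abel_pi a + _]piD !piM mulrDl [RHS]piD.
Qed.
Let multDr : right_distributive mult +%R.
Proof.
elim/abel_ind=> a; elim/abel_ind=> b; elim/abel_ind=> c.
by rewrite [abel_pi b + _]piD !piM mulrDr [RHS]piD.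
Qed.
Let scaleAl (c : k) (x y : abel) : c *: mult x y = mult (c *: x) y.
Proof.
elim/abel_ind: x => x; elim/abel_ind: y => y.
by rewrite piM [LHS]piZ [c *: abel_pi x]piZ piM pzscalerAl.
Qed.
Let scaleAr (c : k) (x y : abel) : c *: mult x y = mult x (c *: y).
Proof.
elim/abel_ind: x => x; elim/abel_ind: y => y.
by rewrite piM [LHS]piZ [c *: abel_pi y]piZ piM pzscalerAr.
Qed.
HB.instance Definition _ := Lmodule_isPzAlgebra.Build k abel
  multA mult1l mult1r multDl multDr scaleAl scaleAr.

Let multC : commutative (@amul k abel).
Proof.
elim/abel_ind=> a; elim/abel_ind=> b; rewrite [LHS]piM [RHS]piM.
by apply/abel_piP; apply: comm_idealC.
Qed.
HB.instance Definition _ := PzAlgebra_hasCommutativeMul.Build k abel multC.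

Lemma abel_pi_linear : linear abel_pi.
Proof. by move=> c a b; rewrite [c *: abel_pi a]piZ [RHS]piD. Qed.
Lemma abel_pi_monoid :
  GRing.monoid_morphism (abel_pi : B -> (abel : pzAlgType k)).
Proof. by split=> // a b; rewrite [RHS]piM. Qed.
Definition abel_proj : alg_hom B abel := AlgHom abel_pi_linear abel_pi_monoid.
End Abelianization.

Section AlgHoms.
Variable k : fieldType.

Lemma alg_id_monoid (A : pzAlgType k) : GRing.monoid_morphism (fun x : A => x).
Proof. by []. Qed.
Definition alg_id (A : pzAlgType k) : alg_hom A A :=
  AlgHom (@lin_id k A) (alg_id_monoid A).

Lemma alg_comp_monoid (A B C : pzAlgType k) (g : alg_hom B C) (f : alg_hom A B) :
  GRing.monoid_morphism (fun x => g (f x)).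
Proof.
split=> [|x y]; first by rewrite (ahom_monoid f).1 (ahom_monoid g).1.
by rewrite (ahom_monoid f).2 (ahom_monoid g).2.
Qed.
Definition alg_comp (A B C : pzAlgType k) (g : alg_hom B C) (f : alg_hom A B) :
    alg_hom A C :=
  AlgHom (lin_comp (ahom_linear g) (ahom_linear f)) (alg_comp_monoid g f).

Lemma alg_hom_comm (A B : pzAlgType k) (f : alg_hom A B) :
  (forall x y : B, x * y = y * x) -> forall x, comm_ideal x -> f x = 0.
Proof.
move=> hB x h; apply: (h (fun x => f x = 0)).
  have f0 : f 0 = 0 by rewrite -(scale0r 0) (lin_scale _ _ (ahom_linear f)) scale0r.
  split=> // [y z fy fz|a y fy|a y fy].
  - by rewrite -[y]scale1r (ahom_linear f) scale1r fy fz addr0.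
  - by rewrite (ahom_monoid f).2 fy mulr0.
  by rewrite (ahom_monoid f).2 fy mul0r.
move=> a b; rewrite addrC -scaleN1r (ahom_linear f) !(ahom_monoid f).2.
by rewrite hB scaleN1r addNr.
Qed.

Section AbelLift.
Variables (A : pzAlgType k) (B : pzAlgType k) (f : alg_hom A B).
Hypothesis hB : forall x y : B, x * y = y * x.

Definition abel_lift_fun (x : abel A) : B := f (generic_quotient.repr x).

Lemma abel_lift_pi a : abel_lift_fun (abel_pi a) = f a.
Proof.
have /(alg_hom_comm f hB) : comm_ideal (repr (abel_pi a) - a).
  by apply/abel_piP; rewrite abel_reprK.
rewrite addrC -scaleN1r (ahom_linear f) scaleN1r => /eqP.
by rewrite addrC subr_eq0 => /eqP.
Qed.

Lemma abel_lift_linear : linear abel_lift_fun.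
Proof.
move=> c; elim/abel_ind=> a; elim/abel_ind=> b.
by rewrite -abel_pi_linear !abel_lift_pi (ahom_linear f).
Qed.
Lemma abel_lift_monoid :
  GRing.monoid_morphism (abel_lift_fun : (abel A : pzAlgType k) -> B).
Proof.
split; first by rewrite -(ahom_monoid (abel_proj A)).1 abel_lift_pi (ahom_monoid f).1.
elim/abel_ind=> a; elim/abel_ind=> b.
by rewrite -(ahom_monoid (abel_proj A)).2 !abel_lift_pi (ahom_monoid f).2.
Qed.
Definition abel_lift : alg_hom (abel A) B :=
  AlgHom abel_lift_linear abel_lift_monoid.
End AbelLift.

Lemma comPz_mulC (B : comPzAlgType k) (x y : B) :
  (x : (B : pzAlgType k)) * y = (y : (B : pzAlgType k)) * x.
Proof. exact: amulC. Qed.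

Definition abel_map (A B : pzAlgType k) (f : alg_hom A B) : alg_hom (abel A) (abel B) :=
  abel_lift (alg_comp (abel_proj B) f) (@comPz_mulC (abel B)).

Lemma abel_mapE (A B : pzAlgType k) (f : alg_hom A B) a :
  abel_map f (abel_pi a) = abel_pi (f a).
Proof. exact: (abel_lift_pi (alg_comp (abel_proj B) f) (@comPz_mulC (abel B))). Qed.
End AlgHoms.

Section WheelHoms.
Variable k : fieldType.

Lemma wheel_id_morphism (A : wheelgebra k) :
  is_wheelgebra_morphism (fun n (a : A n) => a).
Proof. by split=> //; split=> //; split=> // n; apply: lin_id. Qed.
Definition wheel_id (A : wheelgebra k) := WheelgebraHom (wheel_id_morphism A).

Lemma wheel_comp_morphism (A B C : wheelgebra k) (g : wheelgebra_hom B C)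
  (f : wheelgebra_hom A B) : is_wheelgebra_morphism (fun n (a : A n) => g n (f n a)).
Proof.
have [[[f1 f2 f3] f4] f5 f6] := whom_morphism f.
have [[[g1 g2 g3] g4] g5 g6] := whom_morphism g.
split; first split; first split.
- by move=> n; apply: lin_comp.
- by move=> n s v; rewrite f2 g2.
- by move=> n s v; rewrite f3 g3.
- by move=> n j i v; rewrite f4 g4.
- by move=> n m a b; rewrite f5 g5.
by rewrite f6 g6.
Qed.
Definition wheel_comp (A B C : wheelgebra k) (g : wheelgebra_hom B C)
    (f : wheelgebra_hom A B) : wheelgebra_hom A C :=
  WheelgebraHom (wheel_comp_morphism g f).
End WheelHoms.

Record category := Category {
  ob :> Type;
  hom : ob -> ob -> Type;
  idm : forall A, hom A A;
  comp : forall A B C, hom B C -> hom A B -> hom A C;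
  comp_idl : forall A B (f : hom A B), comp (idm B) f = f;
  comp_idr : forall A B (f : hom A B), comp f (idm A) = f;
  compA : forall A B C D (h : hom C D) (g : hom B C) (f : hom A B),
    comp h (comp g f) = comp (comp h g) f
}.

Record functor (C D : category) := Functor {
  fob :> C -> D;
  fmap : forall A B : C, hom A B -> hom (fob A) (fob B);
  fmap_id : forall A, fmap (idm A) = idm (fob A);
  fmap_comp : forall (A B B' : C) (g : hom B B') (f : hom A B),
    fmap (comp g f) = comp (fmap g) (fmap f)
}.

Section FunctorComp.
Variables (C D E : category) (G : functor D E) (F : functor C D).
Lemma functor_comp_id A : fmap G (fmap F (idm A)) = idm (G (F A)).
Proof. by rewrite !fmap_id. Qed.
Lemma functor_comp_comp (A B B' : C) (g : hom B B') (f : hom A B) :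
  fmap G (fmap F (comp g f)) = comp (fmap G (fmap F g)) (fmap G (fmap F f)).
Proof. by rewrite !fmap_comp. Qed.
Definition functor_comp : functor C E :=
  Functor functor_comp_id functor_comp_comp.
End FunctorComp.

Definition left_adjoint (C D : category) (F : functor C D) (G : functor D C) : Prop :=
  exists Phi : forall (A : C) (B : D), hom (F A) B -> hom A (G B),
    [/\ forall A B, bijective (@Phi A B),
        forall (A A' : C) (B : D) (f : hom A' A) (u : hom (F A) B),
          Phi A' B (comp u (fmap F f)) = comp (Phi A B u) f
      & forall (A : C) (B B' : D) (g : hom B B') (u : hom (F A) B),
          Phi A B' (comp g u) = comp (fmap G g) (Phi A B u)].

Section Categories.
Variable k : fieldType.

Lemma alg_comp_idl (A B : pzAlgType k) (f : alg_hom A B) : alg_comp (alg_id B) f = f.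
Proof. exact: alg_hom_ext. Qed.
Lemma alg_comp_idr (A B : pzAlgType k) (f : alg_hom A B) : alg_comp f (alg_id A) = f.
Proof. exact: alg_hom_ext. Qed.
Lemma alg_compA (A B C D : pzAlgType k) (h : alg_hom C D) (g : alg_hom B C)
  (f : alg_hom A B) : alg_comp h (alg_comp g f) = alg_comp (alg_comp h g) f.
Proof. exact: alg_hom_ext. Qed.

Definition Alg : category :=
  @Category (pzAlgType k) (@alg_hom k) (@alg_id k) (@alg_comp k)
    alg_comp_idl alg_comp_idr alg_compA.

Definition CAlg : category :=
  @Category (comPzAlgType k) (fun A B => alg_hom A B) (fun A => alg_id A)
    (fun A B C => @alg_comp k A B C) (fun A B => @alg_comp_idl A B)
    (fun A B => @alg_comp_idr A B) (fun A B C D => @alg_compA A B C D).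

Definition CAlg_incl : functor CAlg Alg :=
  @Functor CAlg Alg (fun B : comPzAlgType k => B : pzAlgType k) (fun A B f => f)
    (fun A => erefl) (fun A B C g f => erefl).

Lemma wheel_comp_idl (A B : wheelgebra k) (f : wheelgebra_hom A B) :
  wheel_comp (wheel_id B) f = f.
Proof. exact: wheelgebra_hom_ext. Qed.
Lemma wheel_comp_idr (A B : wheelgebra k) (f : wheelgebra_hom A B) :
  wheel_comp f (wheel_id A) = f.
Proof. exact: wheelgebra_hom_ext. Qed.
Lemma wheel_compA (A B C D : wheelgebra k) (h : wheelgebra_hom C D)
  (g : wheelgebra_hom B C) (f : wheelgebra_hom A B) :
  wheel_comp h (wheel_comp g f) = wheel_comp (wheel_comp h g) f.
Proof. exact: wheelgebra_hom_ext. Qed.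

Definition WAlg : category :=
  @Category (wheelgebra k) (@wheelgebra_hom k) (@wheel_id k) (@wheel_comp k)
    wheel_comp_idl wheel_comp_idr wheel_compA.

Lemma abel_map_id (A : pzAlgType k) : abel_map (alg_id A) = alg_id (abel A).
Proof. by apply: alg_hom_ext; apply: abel_ind => a; rewrite abel_mapE. Qed.
Lemma abel_map_comp (A B C : pzAlgType k) (g : alg_hom B C) (f : alg_hom A B) :
  abel_map (alg_comp g f) = alg_comp (abel_map g) (abel_map f).
Proof.
apply: alg_hom_ext; apply: abel_ind => a.
by rewrite abel_mapE -[RHS]/(abel_map g (abel_map f _)) !abel_mapE.
Qed.

Definition Abelianize : functor Alg CAlg :=
  @Functor Alg CAlg (fun A : pzAlgType k => abel A) (@abel_map k)
    abel_map_id abel_map_comp.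

Section EVFunctor.
Variable V : vectType k.

Lemma EV_hom_id (B : pzAlgType k) : EV_hom V (alg_id B) = wheel_id (EV V B).
Proof.
apply: wheelgebra_hom_ext => n.
apply: tensor_linear_ext; [exact: EV_map_linear|exact: lin_id|].
by move=> f b; exact: EV_mapE.
Qed.
Lemma EV_hom_comp (A B C : pzAlgType k) (g : alg_hom B C) (f : alg_hom A B) :
  EV_hom V (alg_comp g f) = wheel_comp (EV_hom V g) (EV_hom V f).
Proof.
apply: wheelgebra_hom_ext => n.
apply: tensor_linear_ext; [exact: EV_map_linear| |].
  exact: (lin_comp (@EV_map_linear k V B C g n) (@EV_map_linear k V A B f n)).
move=> h b; rewrite [LHS]EV_mapE.
by rewrite [RHS](congr1 (EV_map g (n := n)) (EV_mapE f h b)) EV_mapE.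
Qed.

Definition E_functor : functor Alg WAlg :=
  @Functor Alg WAlg (fun B : pzAlgType k => EV V B) (@EV_hom k V)
    EV_hom_id EV_hom_comp.
End EVFunctor.
End Categories.

Section DualSystems.
Variable k : fieldType.

Definition dual_system (U : lmodType k) (D : seq (U * {linear U -> k^o})) : Prop :=
  forall u, u = \sum_(p <- D) (p.2 u : k) *: p.1.

Lemma con_tuple0_mlin (V : lmodType k) :
  multilinear (fun _ : {ffun 'I_0 -> V} => (1 : k^o)).
Proof. by move=> v []. Qed.

Lemma tpow_dual (V : vectType k) n :
  exists D : seq (tpow V n * {linear tpow V n -> k^o}), dual_system D.
Proof.
elim: n => [|n [D hD]].
  pose L : {linear tpow V 0 -> k^o} := mklinear (mlift_linear (@con_tuple0_mlin V)).
  pose v0 : {ffun 'I_0 -> V} := [ffun=> 0].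
  exists [:: (tprod v0, L)] => u; rewrite big_seq1 /=.
  move: u; apply: tpow_linear_ext; [by [] | |].
    by move=> a x y; rewrite (mlift_linear (@con_tuple0_mlin V)) scalerDl scalerA.
  move=> v; rewrite (mliftE _ (@con_tuple0_mlin V)) scale1r.
  by congr tprod; apply/ffunP => -[].
pose g (al : 'I_(\dim {:V})) (p : tpow V n * {linear tpow V n -> k^o}) :
    tpow V n.+1 * {linear tpow V n.+1 -> k^o} :=
  (ins_op ord0 (basis_vec al) p.1,
   p.2 \o con_op ord0 (dual_vec al) : {linear tpow V n.+1 -> k^o}).
exists [seq g al p | al <- enum 'I_(\dim {:V}), p <- D] => u.
rewrite big_allpairs_dep /= big_enum /=.
transitivity (\sum_al ins_op ord0 (basis_vec al) (con_op ord0 (dual_vec al) u)).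
  pose S : {linear tpow V n.+1 -> tpow V n.+1} :=
    \sum_al (ins_op ord0 (basis_vec al) \o con_op ord0 (dual_vec al)
      : {linear tpow V n.+1 -> tpow V n.+1}).
  have -> : \sum_al ins_op ord0 (basis_vec al) (con_op ord0 (dual_vec al) u) = S u.
    by rewrite /S sumLE.
  move: u; apply: tpow_linear_ext; [by [] | exact: linear_linear |].
  move=> v; rewrite /S sumLE.
  under eq_bigr => al _ do rewrite compLE con_opE linearZZ ins_opE.
  have upd z : ins_tuple ord0 z (del_tuple ord0 v) = update v ord0 z.
    apply/ffunP => j; rewrite !ffunE; case: unliftP => [j' ->|->].
      by rewrite ffunE eq_sym (negPf (neq_lift _ _)).
    by rewrite eqxx.
  have h (z : V) : tprod (update v ord0 z) =
      mklinear (@tprod_multilinear k V n.+1 v ord0) z by [].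
  under eq_bigr => al _ do rewrite upd h -linearZZ.
  rewrite -linear_sum -basis_dual -h; congr tprod; apply/ffunP => j.
  by rewrite !ffunE; case: eqP => [->|].
apply: eq_bigr => al _.
rewrite [X in ins_op _ _ X](hD (con_op ord0 (dual_vec al) u)) linear_sum.
by apply: eq_bigr => p _; rewrite linearZZ.
Qed.

Lemma rank1_linear (U W : lmodType k) (xi : {linear U -> k^o}) (w : W) :
  linear (fun u => (xi u : k) *: w).
Proof. by move=> a x y; rewrite linearP scalerDl scalerA. Qed.
Lemma entry_linear (U W : lmodType k) (u : U) (xi : {linear W -> k^o}) :
  linear (fun f : {linear U -> W} => xi (f u)).
Proof. by move=> a f g; rewrite addLE scaleLE linearP. Qed.

Lemma hom_dual (U W : lmodType k) D D' :
  @dual_system U D -> @dual_system W D' ->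
  exists D'' : seq ({linear U -> W} * {linear {linear U -> W} -> k^o}),
    dual_system D''.
Proof.
move=> hD hD'.
exists [seq (mklinear (rank1_linear p.2 q.1), mklinear (@entry_linear U W p.1 q.2))
       | p <- D, q <- D'] => f.
apply: linear_ext => u; rewrite big_allpairs_dep /= sumLE {1}[u]hD linear_sum.
apply: eq_bigr => p _; rewrite linearZZ [f p.1]hD' scaler_sumr sumLE.
apply: eq_bigr => q _; rewrite scaleLE /= !scalerA mulrC; congr (_ *: _).
by rewrite -hD'.
Qed.

Definition End_dual (V : vectType k) n :=
  projT1 (cid (let: ex_intro D hD := tpow_dual V n in hom_dual hD hD)).
Lemma End_dualP (V : vectType k) n : dual_system (End_dual V n).
Proof. exact: (projT2 (cid _)). Qed.

Lemma slice_bilinear (U W : lmodType k) (xi : {linear U -> k^o}) :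
  bilinear (fun (u : U) (w : W) => (xi u : k) *: w).
Proof.
split=> [w | u a x y]; first exact: rank1_linear.
by rewrite scalerDr !scalerA mulrC.
Qed.
Definition slice (U W : lmodType k) (xi : {linear U -> k^o}) :
    {linear tensor U W -> W} := mklinear (tlift_linear (slice_bilinear W xi)).
Lemma sliceE (U W : lmodType k) (xi : {linear U -> k^o}) u w :
  slice W xi (tens u w) = (xi u : k) *: w.
Proof. exact: (tliftE _ _ (slice_bilinear W xi)). Qed.

Lemma tens_sum (U W : lmodType k) (w : W) (I : Type) (r : seq I) (F : I -> U) :
  tens (\sum_(i <- r) F i) w = \sum_(i <- r) tens (F i) w.
Proof.
by rewrite -[LHS]/(mklinear ((tens_bilinear U W).1 w) _) linear_sum.
Qed.
Lemma tensZl (U W : lmodType k) (a : k) (u : U) (w : W) :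
  tens (a *: u) w = a *: tens u w.
Proof. exact: (lin_scale _ _ ((tens_bilinear U W).1 w)). Qed.
Lemma tensZr (U W : lmodType k) (a : k) (u : U) (w : W) :
  tens u (a *: w) = a *: tens u w.
Proof. exact: (lin_scale _ _ ((tens_bilinear U W).2 u)). Qed.

Lemma tensor_slices (U W : lmodType k) D (x : tensor U W) :
  dual_system D -> x = \sum_(p <- D) tens p.1 (slice W p.2 x).
Proof.
move=> hD.
have hL (p : U * {linear U -> k^o}) : linear (fun x => tens p.1 (slice W p.2 x)).
  exact: lin_comp ((tens_bilinear U W).2 _) (linear_linear _).
pose S : {linear tensor U W -> tensor U W} := \sum_(p <- D) mklinear (hL p).
have -> : \sum_(p <- D) tens p.1 (slice W p.2 x) = S x by rewrite /S sumLE.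
move: x; apply: tensor_linear_ext; [by [] | exact: linear_linear |].
move=> u w; rewrite /S sumLE {1}[u]hD tens_sum; apply: eq_bigr => p _.
by rewrite -[RHS]/(tens p.1 (slice W p.2 (tens u w))) sliceE tensZl tensZr.
Qed.
End DualSystems.

Section Sqrt.
Variables (k : fieldType) (V : vectType k) (A : wheelgebra k).
Local Notation T n := (tpow V n).
Local Notation End n := {linear T n -> T n}.

(* A left adjoint of E_V, obtained as a quotient of formal terms: the symbol   *)
(* TGen a xi stands for the matrix coefficient (xi (x) id)(psi a) of the image *)
(* of a under a morphism psi : A -> E_V(B), and terms are identified when all  *)
(* such psi give them equal values.                                            *)
Inductive aterm : Type :=
  | TGen n (a : A n) (xi : {linear End n -> k^o})
  | TOne
  | TAdd (s t : aterm)
  | TMul (s t : aterm)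
  | TScale (c : k) (s : aterm).
HB.instance Definition _ := gen_eqMixin aterm.
HB.instance Definition _ := gen_choiceMixin aterm.

Fixpoint aeval (B : pzAlgType k) (psi : wheelgebra_hom A (EV V B)) (t : aterm) : B :=
  match t with
  | TGen n a xi => slice B xi (psi n a)
  | TOne => 1
  | TAdd s t => aeval psi s + aeval psi t
  | TMul s t => aeval psi s * aeval psi t
  | TScale c s => c *: aeval psi s
  end.

Definition aterm_eq (s t : aterm) : bool :=
  `[< forall (B : pzAlgType k) (psi : wheelgebra_hom A (EV V B)),
      aeval psi s = aeval psi t >].

Let aterm_eq_refl : reflexive aterm_eq.
Proof. by move=> s; apply/asboolP. Qed.
Let aterm_eq_sym : symmetric aterm_eq.
Proof. by move=> s t; apply/asboolP/asboolP => h B psi; apply/esym/h. Qed.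
Let aterm_eq_trans : transitive aterm_eq.
Proof.
by move=> t s u /asboolP st /asboolP tu; apply/asboolP => B psi; rewrite st tu.
Qed.
Canonical aterm_equiv :=
  EquivRel aterm_eq aterm_eq_refl aterm_eq_sym aterm_eq_trans.

Definition wsqrt := {eq_quot aterm_equiv}.
HB.instance Definition _ := Choice.on wsqrt.

Definition wcls (t : aterm) : wsqrt := \pi_({eq_quot aterm_equiv}) t.
Definition wev (B : pzAlgType k) (psi : wheelgebra_hom A (EV V B)) (x : wsqrt) : B :=
  aeval psi (repr x).

Lemma wev_cls (B : pzAlgType k) (psi : wheelgebra_hom A (EV V B)) t :
  wev psi (wcls t) = aeval psi t.
Proof.
have /eqmodP/asboolP : repr (wcls t) = t %[mod {eq_quot aterm_equiv}].
  by rewrite reprK.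
by apply.
Qed.
Lemma wsqrt_ext x y :
  (forall (B : pzAlgType k) (psi : wheelgebra_hom A (EV V B)),
    wev psi x = wev psi y) -> x = y.
Proof. by move=> h; rewrite -[x]reprK -[y]reprK; apply/eqmodP/asboolP. Qed.

Let sadd (x y : wsqrt) := wcls (TAdd (repr x) (repr y)).
Let smul (x y : wsqrt) := wcls (TMul (repr x) (repr y)).
Let sscale (c : k) (x : wsqrt) := wcls (TScale c (repr x)).
Let sopp (x : wsqrt) := sscale (-1) x.
Let szero := wcls (TScale 0 TOne).
Let sone := wcls TOne.

Section Ev.
Variables (B : pzAlgType k) (psi : wheelgebra_hom A (EV V B)).
Let evD x y : wev psi (sadd x y) = wev psi x + wev psi y.
Proof. by rewrite wev_cls. Qed.
Let evM x y : wev psi (smul x y) = wev psi x * wev psi y.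
Proof. by rewrite wev_cls. Qed.
Let evZ c x : wev psi (sscale c x) = c *: wev psi x.
Proof. by rewrite wev_cls. Qed.
Let evN x : wev psi (sopp x) = - wev psi x.
Proof. by rewrite evZ scaleN1r. Qed.
Let ev0 : wev psi szero = 0.
Proof. by rewrite wev_cls /= scale0r. Qed.
Let ev1 : wev psi sone = 1.
Proof. by rewrite wev_cls. Qed.
Definition wevE := (evD, evM, evN, evZ, ev0, ev1).
End Ev.

Let addA : associative sadd.
Proof. by move=> x y z; apply: wsqrt_ext => B psi; rewrite !wevE addrA. Qed.
Let addC : commutative sadd.
Proof. by move=> x y; apply: wsqrt_ext => B psi; rewrite !wevE addrC. Qed.
Let add0 : left_id szero sadd.
Proof. by move=> x; apply: wsqrt_ext => B psi; rewrite !wevE add0r. Qed.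
Let addN : left_inverse szero sopp sadd.
Proof. by move=> x; apply: wsqrt_ext => B psi; rewrite !wevE addNr. Qed.
HB.instance Definition _ := GRing.isZmodule.Build wsqrt addA addC add0 addN.

Let scaleA a b x : sscale a (sscale b x) = sscale (a * b) x.
Proof. by apply: wsqrt_ext => B psi; rewrite !wevE scalerA. Qed.
Let scale1 : left_id 1 sscale.
Proof. by move=> x; apply: wsqrt_ext => B psi; rewrite !wevE scale1r. Qed.
Let scaleDr : right_distributive sscale +%R.
Proof. by move=> c x y; apply: wsqrt_ext => B psi; rewrite !wevE scalerDr. Qed.
Let scaleDl x : {morph sscale^~ x : a b / a + b}.
Proof. by move=> a b; apply: wsqrt_ext => B psi; rewrite !wevE scalerDl. Qed.
HB.instance Definition _ :=
  GRing.Zmodule_isLmodule.Build k wsqrt scaleA scale1 scaleDr scaleDl.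

Let mulA : associative smul.
Proof. by move=> x y z; apply: wsqrt_ext => B psi; rewrite !wevE mulrA. Qed.
Let mul1l : left_id sone smul.
Proof. by move=> x; apply: wsqrt_ext => B psi; rewrite !wevE mul1r. Qed.
Let mul1r : right_id sone smul.
Proof. by move=> x; apply: wsqrt_ext => B psi; rewrite !wevE mulr1. Qed.
Let mulDl : left_distributive smul +%R.
Proof. by move=> x y z; apply: wsqrt_ext => B psi; rewrite !wevE mulrDl. Qed.
Let mulDr : right_distributive smul +%R.
Proof. by move=> x y z; apply: wsqrt_ext => B psi; rewrite !wevE mulrDr. Qed.
Let scaleAl (c : k) (x y : wsqrt) : c *: smul x y = smul (c *: x) y.
Proof. by apply: wsqrt_ext => B psi; rewrite !wevE pzscalerAl. Qed.
Let scaleAr (c : k) (x y : wsqrt) : c *: smul x y = smul x (c *: y).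
Proof. by apply: wsqrt_ext => B psi; rewrite !wevE pzscalerAr. Qed.
HB.instance Definition _ := Lmodule_isPzAlgebra.Build k wsqrt
  mulA mul1l mul1r mulDl mulDr scaleAl scaleAr.

Section EvHom.
Variables (B : pzAlgType k) (psi : wheelgebra_hom A (EV V B)).
Lemma wev_linear : linear (wev psi).
Proof. by move=> c x y; rewrite !wevE. Qed.
Lemma wev_monoid : GRing.monoid_morphism (wev psi : (wsqrt : pzAlgType k) -> B).
Proof. by split=> [|x y]; rewrite !wevE. Qed.
Definition wev_hom : alg_hom wsqrt B := AlgHom wev_linear wev_monoid.
End EvHom.

Definition wgen n (a : A n) (xi : {linear End n -> k^o}) : wsqrt := wcls (TGen a xi).

Lemma wev_gen (B : pzAlgType k) (psi : wheelgebra_hom A (EV V B)) n (a : A n) xi :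
  wev psi (wgen a xi) = slice B xi (psi n a).
Proof. exact: wev_cls. Qed.

Lemma wsqrt_hom_ext (B : pzAlgType k) (f g : alg_hom wsqrt B) :
  (forall n (a : A n) xi, f (wgen a xi) = g (wgen a xi)) -> f = g.
Proof.
move=> fg; apply: alg_hom_ext => x; rewrite -[x]reprK -/(wcls _).
have clsD s t : wcls (TAdd s t) = 1 *: wcls s + wcls t.
  by rewrite scale1r; apply: wsqrt_ext => C psi; rewrite [RHS]wevE !wev_cls.
have clsM s t : wcls (TMul s t) = (wcls s : (wsqrt : pzAlgType k)) * wcls t.
  by apply: wsqrt_ext => C psi; rewrite [RHS]wevE !wev_cls.
have clsZ c s : wcls (TScale c s) = c *: wcls s.
  by apply: wsqrt_ext => C psi; rewrite [RHS]wevE !wev_cls.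
have cls1 : wcls TOne = (1 : (wsqrt : pzAlgType k)) by [].
elim: (repr x) => [n a xi||s hs t ht|s hs t ht|c s hs]; first exact: fg.
- by rewrite cls1 (ahom_monoid f).1 (ahom_monoid g).1.
- by rewrite clsD !ahom_linear hs ht.
- by rewrite clsM (ahom_monoid f).2 (ahom_monoid g).2 hs ht.
by rewrite clsZ !(lin_scale _ _ (ahom_linear _)) hs.
Qed.

Definition wunit_fun n (a : A n) : EV V wsqrt n :=
  \sum_(p <- End_dual V n) tens p.1 (wgen a p.2).

Lemma slice_EV_map (B B' : pzAlgType k) (f : alg_hom B B') n xi (x : EV V B n) :
  slice B' xi (EV_map f x) = f (slice B xi x).
Proof.
move: x; apply: tensor_linear_ext.
- exact: lin_comp (linear_linear (slice B' xi)) (@EV_map_linear k V B B' f n).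
- exact: lin_comp (ahom_linear f) (linear_linear (slice B xi)).
by move=> g b; rewrite EV_mapE !sliceE (lin_scale _ _ (ahom_linear f)).
Qed.

Lemma EV_map_unit (B : pzAlgType k) (psi : wheelgebra_hom A (EV V B)) n (a : A n) :
  EV_map (wev_hom psi) (wunit_fun a) = psi n a.
Proof.
rewrite -[EV_map _ _]/(mklinear (@EV_map_linear k V _ B (wev_hom psi) n) _).
rewrite linear_sum [RHS](tensor_slices _ (@End_dualP k V n)).
by apply: eq_bigr => p _; rewrite [LHS]EV_mapE /= wev_gen.
Qed.

Lemma EV_wsqrt_ext n (x y : EV V wsqrt n) :
  (forall (B : pzAlgType k) (psi : wheelgebra_hom A (EV V B)),
    EV_map (wev_hom psi) x = EV_map (wev_hom psi) y) -> x = y.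
Proof.
move=> h; rewrite [x](tensor_slices _ (@End_dualP k V n)).
rewrite [y](tensor_slices _ (@End_dualP k V n)); apply: eq_bigr => p _.
congr tens; apply: wsqrt_ext => B psi.
transitivity (slice B p.2 (EV_map (wev_hom psi) x)).
  by rewrite (slice_EV_map (wev_hom psi)).
by rewrite h (slice_EV_map (wev_hom psi)).
Qed.

Lemma wunit_morphism : is_wheelgebra_morphism wunit_fun.
Proof.
split; first split; first split.
- move=> n c a b; apply: EV_wsqrt_ext => B psi.
  have [[[h _ _] _] _ _] := whom_morphism psi.
  by rewrite EV_map_linear !EV_map_unit h.
- move=> n s a; apply: EV_wsqrt_ext => B psi.
  have [[[_ h _] _] _ _] := whom_morphism psi.
  have [[[_ h' _] _] _ _] := EV_map_morphism V (wev_hom psi).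
  by rewrite h' !EV_map_unit h.
- move=> n s a; apply: EV_wsqrt_ext => B psi.
  have [[[_ _ h] _] _ _] := whom_morphism psi.
  have [[[_ _ h'] _] _ _] := EV_map_morphism V (wev_hom psi).
  by rewrite h' !EV_map_unit h.
- move=> n j i a; apply: EV_wsqrt_ext => B psi.
  have [[_ h] _ _] := whom_morphism psi.
  have [[_ h'] _ _] := EV_map_morphism V (wev_hom psi).
  by rewrite h' !EV_map_unit h.
- move=> n m a b; apply: EV_wsqrt_ext => B psi.
  have [_ h _] := whom_morphism psi.
  have [_ h' _] := EV_map_morphism V (wev_hom psi).
  by rewrite h' !EV_map_unit h.
apply: EV_wsqrt_ext => B psi.
have [_ _ h] := whom_morphism psi.
have [_ _ h'] := EV_map_morphism V (wev_hom psi).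
by rewrite h' EV_map_unit h.
Qed.
Definition wunit : wheelgebra_hom A (EV V wsqrt) := WheelgebraHom wunit_morphism.

Lemma wev_unit (B : pzAlgType k) (psi : wheelgebra_hom A (EV V B)) :
  wheel_comp (EV_hom V (wev_hom psi)) wunit = psi.
Proof. by apply: wheelgebra_hom_ext => n a; exact: EV_map_unit. Qed.

Lemma slice_unit n (a : A n) xi : slice wsqrt xi (wunit_fun a) = wgen a xi.
Proof.
apply: wsqrt_ext => B psi; rewrite wev_gen -(EV_map_unit psi).
by rewrite (slice_EV_map (wev_hom psi)).
Qed.

Lemma unit_wev (B : pzAlgType k) (f : alg_hom wsqrt B) :
  wev_hom (wheel_comp (EV_hom V f) wunit) = f.
Proof.
apply: wsqrt_hom_ext => n a xi.
rewrite [LHS]wev_gen /= [LHS](@slice_EV_map _ _ f).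
by rewrite slice_unit.
Qed.
End Sqrt.

Section SqrtFunctor.
Variables (k : fieldType) (V : vectType k).

Definition wsqrt_map (A A' : wheelgebra k) (h : wheelgebra_hom A A') :
    alg_hom (wsqrt V A) (wsqrt V A') :=
  wev_hom (wheel_comp (wunit V A') h).

Lemma wsqrt_map_unit (A A' : wheelgebra k) (h : wheelgebra_hom A A') :
  wheel_comp (EV_hom V (wsqrt_map h)) (wunit V A) = wheel_comp (wunit V A') h.
Proof. exact: wev_unit. Qed.

Lemma wsqrt_map_id (A : wheelgebra k) :
  wsqrt_map (wheel_id A) = alg_id (wsqrt V A).
Proof.
rewrite -[RHS](unit_wev (alg_id (wsqrt V A))) EV_hom_id.
by rewrite wheel_comp_idl /wsqrt_map wheel_comp_idr.
Qed.
Lemma wsqrt_map_comp (A B C : wheelgebra k) (g : wheelgebra_hom B C)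
  (f : wheelgebra_hom A B) :
  wsqrt_map (wheel_comp g f) = alg_comp (wsqrt_map g) (wsqrt_map f).
Proof.
rewrite -[RHS]unit_wev EV_hom_comp -wheel_compA wsqrt_map_unit.
by rewrite wheel_compA wsqrt_map_unit -wheel_compA.
Qed.

Definition wsqrt_functor : functor (WAlg k) (Alg k) :=
  @Functor (WAlg k) (Alg k) (fun A : wheelgebra k => wsqrt V A) wsqrt_map
    wsqrt_map_id wsqrt_map_comp.

Theorem wsqrt_adjoint : left_adjoint wsqrt_functor (E_functor V).
Proof.
exists (fun (A : wheelgebra k) (B : pzAlgType k) (u : alg_hom (wsqrt V A) B) =>
  wheel_comp (EV_hom V u) (wunit V A)); split.
- move=> A B; exists (fun psi => wev_hom psi) => [u|psi]; first exact: unit_wev.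
  exact: wev_unit.
- move=> A A' B f u /=; rewrite EV_hom_comp -!wheel_compA.
  by rewrite wsqrt_map_unit.
- by move=> A B B' g u /=; rewrite EV_hom_comp -wheel_compA.
Qed.
End SqrtFunctor.

(* Main.v *)
Require Import Defs.
From mathcomp Require Import all_boot all_fingroup all_algebra.
Import GRing.Theory.
Local Open Scope ring_scope.

(** Both functors of the theorem are composites: abelianization after a left
    adjoint of E_V on one side, E_V after the inclusion of commutative algebras
    on the other.  An algebra morphism into a commutative algebra kills the
    commutators, so it factors uniquely through the abelianization; hence
    abelianization is left adjoint to the inclusion ([abelianize_adjoint]).
    The theorem follows because adjunctions compose ([left_adjoint_comp]). *)

(** The bijection of the composite adjunction is
    hom (F' (F A)) B ~ hom (F A) (G' B) ~ hom A (G (G' B)); in its naturality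
    in A, the map F f produced by the outer functor is precisely what the
    naturality of the inner bijection consumes, and dually in B. *)
Lemma left_adjoint_comp (C D E : category) (F : functor C D) (G : functor D C)
    (F' : functor D E) (G' : functor E D) :
  left_adjoint F G -> left_adjoint F' G' ->
  left_adjoint (functor_comp F' F) (functor_comp G G').
Proof.
move=> [Phi [Phi_bij Phi_l Phi_r]] [Psi [Psi_bij Psi_l Psi_r]].
exists (fun A B u => Phi A (G' B) (Psi (F A) B u)); split.
- move=> A B; exact: (bij_comp (Phi_bij A (G' B)) (Psi_bij (F A) B)).
- by move=> A A' B f u; rewrite Psi_l Phi_l.
- by move=> A B B' g u; rewrite Psi_r Phi_r.
Qed.

(** Restriction along the projection A -> A_ab is injective because the projection
    is surjective, and surjective onto the morphisms to a commutative B because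
    these vanish on the commutator ideal. *)
Lemma abelianize_adjoint (k : fieldType) :
  left_adjoint (Abelianize k) (CAlg_incl k).
Proof.
exists (fun (A : pzAlgType k) (B : comPzAlgType k) (u : alg_hom (abel A) B) =>
  alg_comp u (abel_proj A)); split.
- move=> A B; exists (fun f : alg_hom A B => abel_lift f (@comPz_mulC k B)).
    move=> u; apply: alg_hom_ext; apply: abel_ind => a.
    exact: (abel_lift_pi (alg_comp u (abel_proj A)) (@comPz_mulC k B)).
  by move=> f; apply: alg_hom_ext => a;
    exact: (abel_lift_pi f (@comPz_mulC k B)).
- move=> A A' B f u; apply: alg_hom_ext => a.
  exact: (congr1 u (abel_mapE f a)).
- by move=> A B B' g u; apply: alg_hom_ext.
Qed.

Theorem corollary7p6 (k : fieldType) (char_k : [pchar k] =i pred0)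
    (V : vectType k) (sqrt_wh : functor (WAlg k) (Alg k))
    (sqrt_wh_adj : left_adjoint sqrt_wh (E_functor V)) :
  left_adjoint (functor_comp (Abelianize k) sqrt_wh)
               (functor_comp (E_functor V) (CAlg_incl k)).
Proof. exact: left_adjoint_comp sqrt_wh_adj (abelianize_adjoint k). Qed.
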